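(* Let $Q$ be a $k$-subset problem that is superset-closed and that has an FPT algorithm (running time $f(k)\cdot\mathrm{poly}(|I|)$) enumerating all its inclusion-minimal solutions for any instance $(I,k)$, where the number of minimal solutions is bounded by a function of $k$. Then $Q$ Reconfiguration parameterized by $k$ is in FPT, and so are its search variant and its shortest path variant.
   Context: A $k$-subset problem is a parameterized problem $Q$ whose solutions for an instance $(I,k)$ are subsets of size at most $k$ of a domain set (determined by $I$). $Q$ is superset-closed if every superset of size at most $k$ of a solution is also a solution. $Q$ Reconfiguration: given an instance $(I,k)$, two solutions $S,T$ and an integer $\ell$, decide whether there is a sequence $S=U_0,U_1,\dots,U_m=T$ with $m\le \ell$ in which every $U_i$ is a solution of $(I,k)$ (so $|U_i|\le k$) and any two consecutive sets differ by the addition or deletion of exactly one element. The search variant must output such a sequence (a reconfiguration sequence) if one exists; the shortest path variant must output such a sequence of minimum length. A parameterized problem is in FPT if it is decidable/solvable in time $g(p)\cdot n^{c}$ for a function $g$ of the parameter $p$ and a constant $c$. *)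

(* Defs.v *)
From Corelib Require Import PosDef.
From mathcomp Require Import all_boot.
From mathcomp Require Import finmap.

Set Implicit Arguments.
Unset Strict Implicit.
Unset Printing Implicit Defensive.

Local Open Scope fset_scope.

(** * Model of computation

    The machine model is the WHILE language over binary trees, in its
    one-variable form (the language I of N. Jones, "Computability and
    Complexity from a Programming Perspective"): a program transforms the
    current tree.  Every basic step is charged the size of the tree it reads,
    that is, trees are copied and never shared, so that running times are
    polynomially related to those of multitape Turing machines (in both
    directions) and the size of an output never exceeds the time spent on
    producing it. *)

Inductive tree := Leaf | Node of tree & tree.

Fixpoint tsize (t : tree) : nat :=
  if t is Node l r then (tsize l + tsize r).+1 else 1.

Definition thead (t : tree) := if t is Node l _ then l else Leaf.
Definition ttail (t : tree) := if t is Node _ r then r else Leaf.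

(* A test succeeds when the tree it evaluates to is not [Leaf]. *)
Definition truthy (t : tree) : bool := if t is Node _ _ then true else false.

Inductive prog :=
  | PId
  | PNil
  | PHead
  | PTail
  | PCons of prog & prog
  | PSeq of prog & prog
  | PIf of prog & prog & prog
  | PWhile of prog & prog.

(* [eval p x y n]: on input [x], the program [p] halts with output [y] after
   [n] time units. *)
Inductive eval : prog -> tree -> tree -> nat -> Prop :=
  | EId x : eval PId x x (tsize x)
  | ENil x : eval PNil x Leaf (tsize x)
  | EHead x : eval PHead x (thead x) (tsize x)
  | ETail x : eval PTail x (ttail x) (tsize x)
  | ECons p q x y z n m :
      eval p x y n -> eval q x z m ->
      eval (PCons p q) x (Node y z) (tsize x + n + m)
  | ESeq p q x y z n m :
      eval p x y n -> eval q y z m -> eval (PSeq p q) x z (n + m)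
  | EIfTrue c p q x b y n m :
      eval c x b n -> truthy b -> eval p x y m ->
      eval (PIf c p q) x y (tsize x + n + m)
  | EIfFalse c p q x b y n m :
      eval c x b n -> ~~ truthy b -> eval q x y m ->
      eval (PIf c p q) x y (tsize x + n + m)
  | EWhileStop c p x b n :
      eval c x b n -> ~~ truthy b ->
      eval (PWhile c p) x x (tsize x + n)
  | EWhileStep c p x b y z n m l :
      eval c x b n -> truthy b -> eval p x y m -> eval (PWhile c p) y z l ->
      eval (PWhile c p) x z (tsize x + n + m + l).

Lemma eval_det p x y n y' n' :
  eval p x y n -> eval p x y' n' -> y = y' /\ n = n'.
Proof.
move=> H; move: y' n'; elim: H => {p x y n}; intros;
match goal with E : eval _ _ ?y ?n |- _ = ?y /\ _ = ?n => inversion E; subst end;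
repeat match goal with
  | IH : forall y n, eval ?p ?x y n -> _, E : eval ?p ?x _ _ |- _ =>
      case: (IH _ _ E) => ? ?; subst; clear E
  | B : is_true (truthy ?b), B' : is_true (~~ truthy ?b) |- _ =>
      by rewrite B in B'
  end; by [].
Qed.

Lemma eval_size p x y n : eval p x y n -> tsize y <= n.
Proof.
elim=> //=.
- by case.
- by case=> //= l r; rewrite ltnW // ltnS leq_addr.
- by case=> //= l r; rewrite ltnW // ltnS leq_addl.
- move=> _ _ w y' z n' m' _ Hn _ Hm.
  have Hw : 0 < tsize w by case: w.
  by rewrite -addnA -add1n leq_add // leq_add.
- by move=> *; rewrite (leq_trans _ (leq_addl _ _)).
- by move=> *; rewrite (leq_trans _ (leq_addl _ _)).
- by move=> *; rewrite (leq_trans _ (leq_addl _ _)).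
- by move=> *; rewrite leq_addr.
- by move=> *; rewrite (leq_trans _ (leq_addl _ _)).
Qed.

(** * Representation of data by trees

    Representations are relations because a finite set has several codes: it
    may be listed, without repetition, in any order.  Inputs must be accepted
    in every representation; outputs may be produced in any of them. *)

Definition rep (X : Type) := X -> tree -> Prop.

Definition rep_bool : rep bool := fun b t =>
  t = if b then Node Leaf Leaf else Leaf.

Definition rep_pair X Y (rX : rep X) (rY : rep Y) : rep (X * Y) := fun a t =>
  exists u v, [/\ t = Node u v, rX a.1 u & rY a.2 v].

Definition rep_option X (rX : rep X) : rep (option X) := fun a t =>
  if a is Some x then exists2 u, t = Node Leaf u & rX x u else t = Leaf.

Fixpoint rep_seq X (rX : rep X) (s : seq X) (t : tree) : Prop :=
  if s is x :: s' then exists u v, [/\ t = Node u v, rX x u & rep_seq rX s' v]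
  else t = Leaf.

Definition rep_fset (X : choiceType) (rX : rep X) : rep {fset X} := fun A t =>
  exists s : seq X, [/\ uniq s, s =i A & rep_seq rX s t].

Definition word := seq bool.

Definition rep_word : rep word := rep_seq rep_bool.

Fixpoint bits_of_positive (p : positive) : word :=
  match p with
  | xH => [:: true]
  | xO p' => false :: bits_of_positive p'
  | xI p' => true :: bits_of_positive p'
  end.

(* Binary notation, least significant bit first. *)
Definition bits (n : nat) : word :=
  if bin_of_nat n is Npos p then bits_of_positive p else [::].

Definition rep_nat : rep nat := fun n => rep_word (bits n).

(** * Fixed-parameter tractability

    [fpt rX rY par R]: some program maps every code of every [x : X] to a code
    of some [y : Y] with [R x y], in time g(par x) * n ^ c, where n is the size
    of the given code of [x]. *)

Definition fpt X Y (rX : rep X) (rY : rep Y) (par : X -> nat)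
    (R : X -> Y -> Prop) : Prop :=
  exists (p : prog) (g : nat -> nat) (c : nat),
  forall (x : X) (u : tree), rX x u ->
  exists (y : Y) (v : tree) (n : nat),
    [/\ rY y v, R x y, eval p u v n & n <= g (par x) * tsize u ^ c].

Definition fpt_decidable X (rX : rep X) (par : X -> nat) (P : X -> Prop) :=
  fpt rX rep_bool par (fun x b => b <-> P x).

(** * k-subset problems *)

Record subset_problem := SubsetProblem {
  inst : Type;
  inst_code : inst -> word;
  inst_code_inj : injective inst_code;
  elt : choiceType;
  elt_code : elt -> word;
  elt_code_inj : injective elt_code;
  dom : inst -> {pred elt};
  sol : inst -> nat -> {fset elt} -> Prop;
  sol_dom : forall I k S, sol I k S -> {subset S <= dom I};
  sol_card : forall I k S, sol I k S -> #|` S| <= k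
}.

Definition superset_closed (Q : subset_problem) : Prop :=
  forall (I : inst Q) (k : nat) (S S' : {fset elt Q}),
    sol I k S -> S `<=` S' -> {subset S' <= dom I} -> #|` S'| <= k ->
    sol I k S'.

Definition minimal_sol (Q : subset_problem) (I : inst Q) (k : nat)
    (S : {fset elt Q}) : Prop :=
  sol I k S /\ forall S', sol I k S' -> ~ S' `<` S.

Definition is_minimal_family (Q : subset_problem) (I : inst Q) (k : nat)
    (F : {fset {fset elt Q}}) : Prop :=
  forall S, S \in F <-> minimal_sol I k S.

Definition few_minimal_sols (Q : subset_problem) : Prop :=
  exists h : nat -> nat, forall (I : inst Q) (k : nat),
  exists2 F : {fset {fset elt Q}}, is_minimal_family I k F & #|` F| <= h k.

Definition rep_inst (Q : subset_problem) : rep (inst Q) :=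
  fun I => rep_word (inst_code I).

Definition rep_elt (Q : subset_problem) : rep (elt Q) :=
  fun x => rep_word (elt_code x).

Arguments rep_inst : clear implicits.
Arguments rep_elt : clear implicits.

Definition minimal_sols_fpt (Q : subset_problem) : Prop :=
  fpt (rep_pair (rep_inst Q) rep_nat) (rep_fset (rep_fset (rep_elt Q)))
      snd (fun a F => is_minimal_family a.1 a.2 F).

(** * Reconfiguration *)

Definition one_step (T : choiceType) (A B : {fset T}) : Prop :=
  (exists2 x, x \notin A & B = x |` A) \/ (exists2 x, x \in A & B = A `\ x).

(* U lists U_0, ..., U_m. *)
Definition reconf_seq (Q : subset_problem) (I : inst Q) (k : nat)
    (S T : {fset elt Q}) (m : nat) (U : seq {fset elt Q}) : Prop :=
  [/\ size U = m.+1,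
      nth fset0 U 0 = S,
      nth fset0 U m = T,
      forall i, i <= m -> sol I k (nth fset0 U i)
    & forall i, i < m -> one_step (nth fset0 U i) (nth fset0 U i.+1)].

Record endpoints (Q : subset_problem) := Endpoints {
  ep_inst : inst Q;
  ep_k : nat;
  ep_S : {fset elt Q};
  ep_T : {fset elt Q};
  ep_S_sol : sol ep_inst ep_k ep_S;
  ep_T_sol : sol ep_inst ep_k ep_T
}.

Definition ep_reconf (Q : subset_problem) (a : endpoints Q) :=
  reconf_seq (ep_inst a) (ep_k a) (ep_S a) (ep_T a).

Definition rep_endpoints (Q : subset_problem) : rep (endpoints Q) := fun a =>
  rep_pair (rep_pair (rep_pair (rep_inst Q) rep_nat) (rep_fset (rep_elt Q)))
           (rep_fset (rep_elt Q))
    (ep_inst a, ep_k a, ep_S a, ep_T a).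

Arguments rep_endpoints : clear implicits.

(* Instances of Q Reconfiguration: endpoints together with the bound ell. *)
Definition reconf_inst (Q : subset_problem) : Type := (endpoints Q * nat)%type.

Definition rep_reconf_inst (Q : subset_problem) : rep (reconf_inst Q) :=
  rep_pair (rep_endpoints Q) rep_nat.

Arguments rep_reconf_inst : clear implicits.

Definition reconf_par (Q : subset_problem) (a : reconf_inst Q) : nat :=
  ep_k a.1.

Definition rep_answer (Q : subset_problem) : rep (option (seq {fset elt Q})) :=
  rep_option (rep_seq (rep_fset (rep_elt Q))).

Arguments rep_answer : clear implicits.

Definition reconf_fpt (Q : subset_problem) : Prop :=
  fpt_decidable (rep_reconf_inst Q) (@reconf_par Q)
    (fun a => exists m U, m <= a.2 /\ ep_reconf a.1 m U).

(* In the following, the answer [None] reports that no sequence exists. *)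

Definition search_reconf_fpt (Q : subset_problem) : Prop :=
  fpt (rep_reconf_inst Q) (rep_answer Q) (@reconf_par Q)
    (fun a ans =>
       if ans is Some U then exists2 m, m <= a.2 & ep_reconf a.1 m U
       else forall m U, m <= a.2 -> ~ ep_reconf a.1 m U).

Definition is_shortest (Q : subset_problem) (a : endpoints Q) (m : nat)
    (U : seq {fset elt Q}) : Prop :=
  ep_reconf a m U /\ forall m' U', ep_reconf a m' U' -> m <= m'.

Definition shortest_reconf_fpt (Q : subset_problem) : Prop :=
  fpt (rep_reconf_inst Q) (rep_answer Q) (@reconf_par Q)
    (fun a ans =>
       if ans is Some U then exists2 m, m <= a.2 & is_shortest a.1 m U
       else forall m U, m <= a.2 -> ~ ep_reconf a.1 m U).

(* The shortest path variant with no bound ell in the input. *)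
Definition shortest_unbounded_reconf_fpt (Q : subset_problem) : Prop :=
  fpt (rep_endpoints Q) (rep_answer Q) (@ep_k Q)
    (fun a ans =>
       if ans is Some U then exists m, is_shortest a m U
       else forall m U, ~ ep_reconf a m U).

(* Main.v *)
(** Every solution contains a minimal one, so intersecting all the sets of a
    reconfiguration sequence with C, the union of S, T and the minimal
    solutions, leaves a sequence of solutions of at most the same length.  Hence
    shortest sequences may be searched among the subsets of C, where C has at
    most k (h k + 2) elements.

    After the enumeration of the minimal solutions, a polynomial-time program
    replaces all sets by their bit masks over C, and the bound ell, when its
    binary notation is longer than |C|, by a number that exceeds the length of
    every shortest sequence.  The size of the resulting instance depends on k
    only, so it can be solved by any terminating program; a last
    polynomial-time program turns the masks back into sets. *)

Require Import Defs.
From mathcomp Require Import all_boot finmap.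
From mathcomp Require Import zify.
(* [tuple] shadows [Defs.tsize]. *)
Import Defs.

Set Implicit Arguments.
Unset Strict Implicit.
Unset Printing Implicit Defensive.

(** * Computation on typed data *)

Definition bound (poly : bool) (T : nat -> nat) : Prop :=
  {homo T : m n / m <= n} /\
  (poly -> exists c, forall s, 0 < s -> T s <= c * s ^ c).

Section Bounds.
Variable b : bool.

Lemma bound_id : bound b id.
Proof. by split=> // _; exists 1 => s; rewrite expn1 mul1n. Qed.

Lemma bound_const k : bound b (fun=> k).
Proof.
by split=> // _; exists k => s s_gt0; rewrite leq_pmulr // expn_gt0 s_gt0.
Qed.

Lemma bound_add T U : bound b T -> bound b U -> bound b (fun s => T s + U s).
Proof.
move=> [mT pT] [mU pU]; split=> [m n le_mn|pb].
  by rewrite leq_add ?mT ?mU.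
have [c Hc] := pT pb; have [d Hd] := pU pb; exists (c + d) => s s_gt0.
rewrite mulnDl leq_add // ?(leq_trans (Hc _ s_gt0)) ?(leq_trans (Hd _ s_gt0)) //.
  by rewrite leq_mul2l leq_pexp2l ?leq_addr ?orbT.
by rewrite leq_mul2l leq_pexp2l ?leq_addl ?orbT.
Qed.

Lemma bound_mul T U : bound b T -> bound b U -> bound b (fun s => T s * U s).
Proof.
move=> [mT pT] [mU pU]; split=> [m n le_mn|pb].
  by rewrite leq_mul ?mT ?mU.
have [c Hc] := pT pb; have [d Hd] := pU pb.
exists (c * d + (c + d)) => s s_gt0.
rewrite (leq_trans (leq_mul (Hc _ s_gt0) (Hd _ s_gt0))) // mulnACA -expnD.
by rewrite leq_mul ?leq_addr // leq_pexp2l ?leq_addl.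
Qed.

Lemma bound_comp T U : bound b T -> bound b U -> bound b (fun s => T (U s)).
Proof.
move=> [mT pT] [mU pU]; split=> [m n le_mn|pb]; first by rewrite mT ?mU.
have [c Hc] := pT pb; have [d Hd] := pU pb.
exists (c * d.+1 ^ c + d * c) => s s_gt0.
have le1 : T (U s) <= T (d.+1 * s ^ d).
  by rewrite mT // (leq_trans (Hd _ s_gt0)) // leq_mul2r leqnSn orbT.
rewrite (leq_trans le1) // (leq_trans (Hc _ _)) ?muln_gt0 ?expn_gt0 ?s_gt0 //.
rewrite expnMn -expnM mulnA leq_mul ?leq_addr // leq_pexp2l ?leq_addl //.
Qed.

End Bounds.

Structure coded := Coded { cval :> Type; enc : cval -> tree }.
Arguments enc : simpl never.
Arguments tsize : simpl never.

Definition enc_bool (x : bool) := if x then Node Leaf Leaf else Leaf.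
Canonical bool_coded := Coded enc_bool.

Definition enc_pair (X Y : coded) (x : X * Y) := Node (enc x.1) (enc x.2).
Canonical pair_coded (X Y : coded) := Coded (@enc_pair X Y).

Definition enc_seq (X : coded) (s : seq X) :=
  foldr (fun x t => Node (enc x) t) Leaf s.
Canonical seq_coded (X : coded) := Coded (@enc_seq X).

Definition enc_option (X : coded) (o : option X) :=
  if o is Some x then Node Leaf (enc x) else Leaf.
Canonical option_coded (X : coded) := Coded (@enc_option X).

Notation csize x := (tsize (enc x)).

(* [b = true] requires polynomial time, [b = false] only termination. *)
Definition computable (b : bool) (A B : coded) (f : A -> B) : Prop :=
  exists p T, bound b T /\
  forall a, exists2 n, eval p (enc a) (enc (f a)) n & n <= T (csize a).

Lemma tsize_gt0 t : 0 < tsize t. Proof. by case: t. Qed.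

Lemma csize_pair (X Y : coded) (x : X * Y) :
  csize x = (csize x.1 + csize x.2).+1.
Proof. by []. Qed.

Lemma csize_cons (X : coded) (x : X) s :
  csize (x :: s) = (csize x + csize s).+1.
Proof. by []. Qed.

Lemma csize_nil (X : coded) : csize ([::] : seq X) = 1. Proof. by []. Qed.

Lemma csize_Some (X : coded) (x : X) : csize (Some x) = (csize x).+2.
Proof. by []. Qed.

Lemma csize_bool (x : bool) : 0 < csize x <= 3.
Proof. by case: x. Qed.

Section Closure.
Variable b : bool.

Lemma computable_ext (A B : coded) (f g : A -> B) :
  f =1 g -> computable b f -> computable b g.
Proof.
move=> fg [p [T [bT Hp]]]; exists p, T; split=> // a.
by rewrite -fg; apply: Hp.
Qed.

Lemma computable_comp (A B C : coded) (f : B -> C) (g : A -> B) :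
  computable b f -> computable b g -> computable b (fun a => f (g a)).
Proof.
move=> [p [T [bT Hp]]] [q [U [bU Hq]]].
exists (PSeq q p), (fun s => U s + T (U s)); split.
  by apply: bound_add => //; apply: bound_comp.
move=> a; have [n En le_n] := Hq a; have [m Em le_m] := Hp (g a).
exists (n + m); first exact: ESeq En Em.
rewrite leq_add // (leq_trans le_m) // bT.1 //.
exact: leq_trans (eval_size En) le_n.
Qed.

Lemma computable_id (A : coded) : computable b (fun a : A => a).
Proof.
exists PId, id; split; first exact: bound_id.
by move=> a; exists (csize a) => //; apply: EId.
Qed.

Lemma computable_pair (A B C : coded) (f : A -> B) (g : A -> C) :
  computable b f -> computable b g -> computable b (fun a => (f a, g a)).
Proof.
move=> [p [T [bT Hp]]] [q [U [bU Hq]]].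
exists (PCons p q), (fun s => s + T s + U s); split.
  by do 2?apply: bound_add => //; apply: bound_id.
move=> a; have [n En le_n] := Hp a; have [m Em le_m] := Hq a.
by exists (csize a + n + m); [apply: ECons | rewrite !leq_add].
Qed.

Lemma computable_fst (A B : coded) : computable b (fun x : A * B => x.1).
Proof.
exists PHead, id; split; first exact: bound_id.
by move=> a; exists (csize a) => //; apply: (EHead (enc a)).
Qed.

Lemma computable_snd (A B : coded) : computable b (fun x : A * B => x.2).
Proof.
exists PTail, id; split; first exact: bound_id.
by move=> a; exists (csize a) => //; apply: (ETail (enc a)).
Qed.

Lemma computable_comp2 (A B C D : coded) (f : B -> C -> D) (g : A -> B)
    (h : A -> C) :
  computable b (fun x : B * C => f x.1 x.2) ->
  computable b g -> computable b h -> computable b (fun a => f (g a) (h a)).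
Proof.
by move=> cf cg ch; apply: (computable_comp cf (computable_pair cg ch)).
Qed.

Lemma computable_cons (A X : coded) (f : A -> X) (g : A -> seq X) :
  computable b f -> computable b g -> computable b (fun a => f a :: g a).
Proof. by move=> cf cg; have := computable_pair cf cg. Qed.

Lemma computable_nil (A X : coded) : computable b (fun _ : A => [::] : seq X).
Proof.
exists PNil, id; split; first exact: bound_id.
by move=> a; exists (csize a) => //; apply: (ENil (enc a)).
Qed.

Lemma computable_None (A X : coded) : computable b (fun _ : A => None : option X).
Proof. by have := computable_nil A X. Qed.

Lemma computable_false (A : coded) : computable b (fun _ : A => false).
Proof. by have := computable_nil A bool_coded. Qed.

Lemma computable_true (A : coded) : computable b (fun _ : A => true).
Proof. by have := computable_cons (computable_false A) (computable_nil A _). Qed.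

Lemma computable_Some (A X : coded) (f : A -> X) :
  computable b f -> computable b (fun a => Some (f a)).
Proof. by move=> cf; have := computable_pair (computable_false A) cf. Qed.

Lemma computable_if (A B : coded) (c : A -> bool) (f g : A -> B) :
  computable b c -> computable b f -> computable b g ->
  computable b (fun a => if c a then f a else g a).
Proof.
move=> [r [R [bR Hr]]] [p [T [bT Hp]]] [q [U [bU Hq]]].
exists (PIf r p q), (fun s => s + R s + (T s + U s)); split.
  by do !apply: bound_add => //; apply: bound_id.
move=> a; have [l El le_l] := Hr a.
case: (boolP (c a)) El => ca El.
  have [n En le_n] := Hp a; exists (csize a + l + n).
    exact: EIfTrue El _ En.
  by rewrite !leq_add // (leq_trans le_n) ?leq_addr.
have [n En le_n] := Hq a; exists (csize a + l + n).
  exact: EIfFalse El _ En.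
by rewrite !leq_add // (leq_trans le_n) ?leq_addl.
Qed.

Lemma computable_behead (X : coded) : computable b (@behead X).
Proof.
exists PTail, id; split; first exact: bound_id.
by move=> s; exists (csize s) => //; case: s => *; apply: ETail.
Qed.

Lemma computable_head (X : coded) (x0 : X) :
  enc x0 = Leaf -> computable b (head x0).
Proof.
move=> x0E; exists PHead, id; split; first exact: bound_id.
by move=> s; exists (csize s) => //; case: s => [|x s] /=; rewrite ?x0E; apply: EHead.
Qed.

Lemma computable_nilp (X : coded) : computable b (@nilp X).
Proof.
exists (PIf PId PNil (PCons PNil PNil)), (fun s => 5 * s); split.
  by apply: bound_mul; [apply: bound_const | apply: bound_id].
case=> [|x s].
  exists 5 => //.
  by apply: (EIfFalse _ (EId _)) => //; apply: (ECons (ENil _) (ENil _)).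
exists (csize (x :: s) + csize (x :: s) + csize (x :: s)); last lia.
by apply: (EIfTrue _ (EId _)) => //; apply: ENil.
Qed.

Lemma computable_option (A X B : coded) (f : A -> option X) (g : A -> X -> B)
    (h : A -> B) :
  computable b f -> computable b (fun x => g x.1 x.2) -> computable b h ->
  computable b (fun a => if f a is Some x then g a x else h a).
Proof.
move=> [r [R [bR Hr]]] [p [T [bT Hp]]] [q [U [bU Hq]]].
exists (PIf r (PSeq (PCons PId (PSeq r PTail)) p) q).
exists (fun s => s + R s + (s + s + R s + R s + T (s + R s).+1 + U s)); split.
  do !apply: bound_add => //; try exact: bound_id.
  apply: (@bound_comp b T (fun s => (s + R s).+1)) => //.
  apply: (@bound_add b (fun _ => 1)); first exact: bound_const.
  by apply: bound_add => //; apply: bound_id.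
move=> a; have [l El le_l] := Hr a.
case fa: (f a) El => [x|] El.
  have [n En le_n] := Hp (a, x).
  have sx := eval_size El; rewrite csize_Some in sx.
  have E2 := ECons (EId (enc a)) (ESeq El (ETail (enc (Some x)))).
  eexists.
    exact: (EIfTrue _ El isT (ESeq E2 En)).
  have : T (csize (a, x)) <= T (csize a + R (csize a)).+1.
    by apply: bT.1; rewrite csize_pair /=; lia.
  by rewrite csize_Some; lia.
have [n En le_n] := Hq a; exists (csize a + l + n).
  exact: EIfFalse El _ En.
rewrite !leq_add // (leq_trans le_n) ?leq_addl //.
Qed.

End Closure.

Lemma csize_seq_ge (X : coded) (s : seq X) : size s < csize s.
Proof.
by elim: s => //= x s IH; rewrite csize_cons ltnS (leq_trans IH) ?leq_addl.
Qed.

Lemma csize_take (X : coded) (s : seq X) i : csize (take i s) <= csize s.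
Proof.
elim: s i => [|x s IH] [|i] //=.
by rewrite !csize_cons ltnS leq_add2l.
Qed.

Section Foldl.
Variables (b : bool) (A X Y : coded).
Variables (f : A -> seq X) (z : A -> Y) (g : A -> Y -> X -> Y).

(* The state of the loop is [(a, (y, l))]: the input, the accumulator and the
   unread part of the list. *)
Let body (p : prog) :=
  PCons PHead
    (PCons (PSeq (PCons PHead (PCons (PSeq PTail PHead)
                                     (PSeq (PSeq PTail PTail) PHead))) p)
           (PSeq (PSeq PTail PTail) PTail)).

Let loop p := PWhile (PSeq PTail PTail) (body p).

Lemma eval_body p a y x l n :
  eval p (enc (a, (y, x))) (enc (g a y x)) n ->
  exists2 m, eval (body p) (enc (a, (y, x :: l))) (enc (a, (g a y x, l))) m
    & m <= 20 * csize (a, (y, x :: l)) + n.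
Proof.
move=> En; set st := enc (a, (y, x :: l)).
have E1 := EHead st.
have E2 := ESeq (ETail st) (EHead (enc (y, x :: l))).
have E3 := ESeq (ETail st) (ETail (enc (y, x :: l))).
have E4 := ESeq E3 (EHead (enc (x :: l))).
have E5 := ESeq E3 (ETail (enc (x :: l))).
have E6 := ESeq (ECons E1 (ECons E2 E4)) En.
eexists; first exact: (ECons E1 (ECons E6 E5)).
rewrite /st !csize_pair csize_cons /=; lia.
Qed.

Lemma eval_loop p (T : nat -> nat) a M L l y :
  {homo T : m n / m <= n} ->
  (forall t : A * (Y * X),
    exists2 n, eval p (enc t) (enc (g t.1 t.2.1 t.2.2)) n & n <= T (csize t)) ->
  csize l <= L ->
  (forall i, csize (foldl (g a) y (take i l)) <= M) ->
  exists2 n, eval (loop p) (enc (a, (y, l))) (enc (a, (foldl (g a) y l, [::] : seq X))) n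
    & n <= (size l).+1 * (23 * (csize a + M + L + 2) + T (csize a + M + L + 2)).
Proof.
move=> mT Hp; set W := 23 * _ + _.
elim: l y => [|x l IH] y sl HM.
  have E := ESeq (ETail (enc (a, (y, [::] : seq X)))) (ETail (enc (y, [::] : seq X))).
  eexists; first exact: (EWhileStop _ E).
  have := HM 0; rewrite /W !csize_pair /= => H; lia.
have E := ESeq (ETail (enc (a, (y, x :: l)))) (ETail (enc (y, x :: l))).
have sy := HM 0; rewrite take0 /= in sy.
rewrite csize_cons in sl.
have [n En le_n] := Hp (a, (y, x)).
have [m Em le_m] := eval_body l En.
have [||k Ek le_k] := IH (g a y x); first lia.
  by move=> i; have := HM i.+1.
eexists; first exact: (EWhileStep E _ Em Ek).
have : T (csize (a, (y, x))) <= T (csize a + M + L + 2).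
  by apply: mT; rewrite !csize_pair /=; lia.
move: le_n le_m le_k; rewrite !csize_pair /= !csize_cons [(size l).+2 * W]mulSn.
set W' := (size l).+1 * W; rewrite /W.
move: (T _) (T _) => ? ?; lia.
Qed.

Hypothesis computable_step :
  computable b (fun t : A * (Y * X) => g t.1 t.2.1 t.2.2).
Hypotheses (computable_f : computable b f) (computable_z : computable b z).
(* Additive growth keeps the accumulator polynomial. *)
Hypothesis growth : b -> exists2 q, bound b q &
  forall a y x, csize (g a y x) <= csize y + q (csize a + csize x).

Lemma foldl_size : exists2 M, bound b M &
  forall a i, csize (foldl (g a) (z a) (take i (f a))) <= M (csize a).
Proof.
have [pf [Tf [bTf Hf]]] := computable_f; have [pz [Tz [bTz Hz]]] := computable_z.
have sf a : csize (f a) <= Tf (csize a).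
  by have [n /eval_size + le_n] := Hf a; move/leq_trans; apply.
have sz a : csize (z a) <= Tz (csize a).
  by have [n /eval_size + le_n] := Hz a; move/leq_trans; apply.
have [[q bq Hq]|nb] : (exists2 q, bound b q &
    forall a y x, csize (g a y x) <= csize y + q (csize a + csize x)) \/ ~~ b.
- by case: (b) growth => H; [left; apply: H | right].
- exists (fun s => Tz s + Tf s * q (s + Tf s)).
    apply: bound_add => //; apply: bound_mul => //; apply: bound_comp => //.
    by apply: bound_add => //; apply: bound_id.
  move=> a i.
  suff H l y : csize l <= csize (f a) -> csize (foldl (g a) y l) <=
      csize y + size l * q (csize a + Tf (csize a)).
    have sl : size (take i (f a)) <= Tf (csize a).
      rewrite size_take_min (leq_trans (geq_minr _ _)) //.
      exact: leq_trans (ltnW (csize_seq_ge _)) (sf a).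
    apply: leq_trans (H _ _ _) _; last by rewrite leq_add ?leq_mul.
    exact: csize_take.
  elim: l y => [|x l IH] y sl /=; first by rewrite addn0.
  rewrite csize_cons in sl.
  apply: leq_trans (IH _ _) _; first lia.
  rewrite mulSn addnA leq_add2r (leq_trans (Hq _ _ _)) // leq_add2l.
  by apply: bq.1; have := sf a; lia.
have [p [T [bT Hp]]] := computable_step.
pose F s m := m + T (s + m + Tf s + 2).
exists (fun s => iter (Tf s) (F s) (Tz s)).
  split=> [m n le_mn|]; last by rewrite (negPf nb).
  apply: (@leq_trans (iter (Tf m) (F n) (Tz n))).
    elim: (Tf m) => [|k IH] /=; first exact: bTz.1.
    by rewrite leq_add ?bT.1 // !leq_add ?bTf.1.
  rewrite -(subnK (bTf.1 _ _ le_mn)) iterD.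
  by elim: (_ - _) => //= k /leq_trans; apply; apply: leq_addr.
move=> a i; set s := csize a.
suff H l y m : csize l <= csize (f a) -> csize y <= m -> csize (foldl (g a) y l) <=
    iter (size l) (F s) m.
  have sl : size (take i (f a)) <= Tf s.
    rewrite size_take_min (leq_trans (geq_minr _ _)) //.
    exact: leq_trans (ltnW (csize_seq_ge _)) (sf a).
  apply: leq_trans (H _ _ _ _ (sz a)) _.
    exact: csize_take.
  rewrite -(subnK sl) iterD.
  by elim: (_ - _) => //= k /leq_trans; apply; apply: leq_addr.
elim: l y m => [|x l IH] y m sl sy //=.
rewrite csize_cons in sl.
rewrite -iterS iterSr; apply: IH; first lia.
have [n /eval_size /= le1 le_n] := Hp (a, (y, x)).
rewrite (leq_trans le1) // (leq_trans le_n) // /F.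
apply: leq_trans (leq_addl _ _); apply: bT.1.
by rewrite !csize_pair /=; have := sf a; rewrite /s; lia.
Qed.

Lemma computable_foldl : computable b (fun a => foldl (g a) (z a) (f a)).
Proof.
have [M bM HM] := foldl_size.
have [pf [Tf [bTf Hf]]] := computable_f; have [pz [Tz [bTz Hz]]] := computable_z.
have [p [T [bT Hp]]] := computable_step.
pose B s := s + M s + Tf s + 2.
have bB : bound b B.
  by do !apply: bound_add => //; [apply: bound_id | apply: bound_const].
exists (PSeq (PCons PId (PCons pz pf)) (PSeq (loop p) (PSeq PTail PHead))).
exists (fun s => 10 * B s + Tz s + Tf s + B s * (23 * B s + T (B s))); split.
  have cB c : bound b (fun s => c * B s) by exact: bound_mul (bound_const _ _) bB.
  exact: bound_add (bound_add (bound_add (cB 10) bTz) bTf)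
                   (bound_mul bB (bound_add (cB 23) (bound_comp bT bB))).
move=> a; have [n En le_n] := Hf a; have [m Em le_m] := Hz a.
have sf := leq_trans (eval_size En) le_n.
have [k Ek le_k] := eval_loop bT.1 Hp sf (HM a).
have E1 := ECons (EId (enc a)) (ECons Em En).
set y := foldl _ _ _ in Ek *.
have E2 := ESeq (ETail (enc (a, (y, [::] : seq X)))) (EHead (enc (y, [::] : seq X))).
eexists; first exact: (ESeq E1 (ESeq Ek E2)).
have := HM a (size (f a)); rewrite take_size -/y => sy.
rewrite !csize_pair csize_nil /=.
have : k <= B (csize a) * (23 * B (csize a) + T (B (csize a))).
  apply: leq_trans le_k _; rewrite leq_mul2r.
  by rewrite (leq_trans (csize_seq_ge _)) ?orbT // /B; lia.
rewrite /B; lia.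
Qed.

End Foldl.

Lemma computable_rev b (X : coded) : computable b (@rev X).
Proof.
apply: (@computable_ext _ _ _ (fun s => foldl (fun t x => x :: t) [::] s)).
  by move=> s; rewrite /rev; elim: s [::] => //=.
apply: (@computable_foldl b _ _ _ id (fun=> [::]) (fun _ t x => x :: t)).
- apply: computable_cons.
    exact: (computable_comp (computable_snd _ _ _) (computable_snd _ _ _)).
  exact: (computable_comp (computable_fst _ _ _) (computable_snd _ _ _)).
- exact: computable_id.
- exact: computable_nil.
exists succn; first exact: (@bound_add b (fun=> 1)) (bound_const _ _) (bound_id _).
by move=> a y x; rewrite csize_cons; lia.
Qed.

Lemma computable_foldr b (A X Y : coded) (f : A -> seq X) (z : A -> Y)
    (g : A -> X -> Y -> Y) :
  computable b (fun t : A * (Y * X) => g t.1 t.2.2 t.2.1) ->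
  computable b f -> computable b z ->
  (b -> exists2 q, bound b q &
    forall a y x, csize (g a x y) <= csize y + q (csize a + csize x)) ->
  computable b (fun a => foldr (g a) (z a) (f a)).
Proof.
move=> cg cf cz growth.
apply: (@computable_ext _ _ _
  (fun a => foldl (fun y x => g a x y) (z a) (rev (f a)))).
  by move=> a; rewrite foldl_rev.
apply: (@computable_foldl b _ _ _ (fun a => rev (f a)) z (fun a y x => g a x y)) => //.
exact: computable_comp (computable_rev _ _) cf.
Qed.

Ltac computable_step := fail.

Ltac computability :=
  cbv beta; try eassumption;
  lazymatch goal with
  | |- @computable _ _ _ (fun t => t) => exact (@computable_id _ _)
  | |- @computable _ _ _ fst => exact (@computable_fst _ _ _)
  | |- @computable _ _ _ snd => exact (@computable_snd _ _ _)
  | |- @computable _ _ _ (fun t => (@?g t).1) =>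
      refine (@computable_comp _ _ _ _ _ g (@computable_fst _ _ _) _); computability
  | |- @computable _ _ _ (fun t => (@?g t).2) =>
      refine (@computable_comp _ _ _ _ _ g (@computable_snd _ _ _) _); computability
  | |- @computable _ _ _ (fun t => (@?f t, @?g t)) =>
      refine (@computable_pair _ _ _ _ f g _ _); computability
  | |- @computable _ _ _ (fun t => @?f t :: @?g t) =>
      refine (@computable_cons _ _ _ f g _ _); computability
  | |- @computable _ _ _ (fun t => Some (@?f t)) =>
      refine (@computable_Some _ _ _ f _); computability
  | |- @computable _ _ _ (fun t => nilp (@?f t)) =>
      refine (@computable_comp _ _ _ _ _ f (@computable_nilp _ _) _); computability
  | |- @computable _ _ _ (fun t => behead (@?f t)) =>
      refine (@computable_comp _ _ _ _ _ f (@computable_behead _ _) _); computability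
  | |- @computable ?b _ _ (fun t => head false (@?f t)) =>
      refine (@computable_comp _ _ _ _ _ f
                (@computable_head b bool_coded false (erefl Leaf)) _);
      computability
  | |- @computable _ _ _ (fun t => true) => exact (@computable_true _ _)
  | |- @computable _ _ _ (fun t => false) => exact (@computable_false _ _)
  | |- @computable _ _ _ (fun t => None) => exact (@computable_None _ _ _)
  | |- @computable _ _ _ (fun t => [::]) => exact (@computable_nil _ _ _)
  | |- _ => try (first [apply computable_id | computable_step | apply computable_if];
                 computability)
  end.

Lemma bound_addn b T k : bound b T -> bound b (fun s => T s + k).
Proof. by move=> bT; apply: bound_add => //; apply: bound_const. Qed.

Section Lists.
Variable b : bool.

Lemma computable_neg (A : coded) (f : A -> bool) :
  computable b f -> computable b (fun a => ~~ f a).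
Proof. by move=> cf; apply: computable_if; computability. Qed.

Lemma computable_and (A : coded) (f g : A -> bool) :
  computable b f -> computable b g -> computable b (fun a => f a && g a).
Proof. by move=> cf cg; apply: computable_if; computability. Qed.

Lemma computable_imp (A : coded) (f g : A -> bool) :
  computable b f -> computable b g -> computable b (fun a => f a ==> g a).
Proof. by move=> cf cg; apply: computable_if; computability. Qed.

Lemma computable_cat (A X : coded) (f g : A -> seq X) :
  computable b f -> computable b g -> computable b (fun a => f a ++ g a).
Proof.
move=> cf cg; apply: (@computable_ext _ _ _ (fun a => foldr cons (g a) (f a))).
  by move=> a; elim: (f a) => //= x s ->.
apply: (@computable_foldr b _ _ _ f g (fun _ => cons)) => //; first by computability.
exists (fun s => s + 1); first by apply: bound_addn; apply: bound_id.
by move=> a y x; rewrite csize_cons; lia.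
Qed.

Lemma computable_map (A X Y : coded) (g : A -> X -> Y) (f : A -> seq X) :
  computable b (fun t => g t.1 t.2) -> computable b f ->
  computable b (fun a => map (g a) (f a)).
Proof.
move=> cg cf.
apply: (@computable_ext _ _ _
  (fun a => foldr (fun x y => g a x :: y) [::] (f a))).
  by move=> a; elim: (f a) => //= x s ->.
apply: (@computable_foldr b _ _ _ f (fun=> [::]) (fun a x y => g a x :: y)) => //.
- by apply: computable_cons; [apply: (computable_comp2 cg) |]; computability.
- exact: computable_nil.
have [p [T [bT Hp]]] := cg => _.
exists (fun s => T (s + 1) + 1).
  by apply: bound_addn; apply: bound_comp => //; apply: bound_addn; apply: bound_id.
move=> a y x; have [n /eval_size le1 le_n] := Hp (a, x).
move: le1 le_n; rewrite csize_cons csize_pair !addn1 /=; lia.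
Qed.

Lemma computable_filter (A X : coded) (g : A -> X -> bool) (f : A -> seq X) :
  computable b (fun t => g t.1 t.2) -> computable b f ->
  computable b (fun a => filter (g a) (f a)).
Proof.
move=> cg cf.
apply: (@computable_ext _ _ _
  (fun a => foldr (fun x y => if g a x then x :: y else y) [::] (f a))).
  by move=> a; elim: (f a) => //= x s ->.
apply: (@computable_foldr b _ _ _ f (fun=> [::])
  (fun a x y => if g a x then x :: y else y)) => //.
- by apply: computable_if; [apply: (computable_comp2 cg) | |]; computability.
- exact: computable_nil.
exists (fun s => s + 1); first by apply: bound_addn; apply: bound_id.
by move=> a y x; case: (g a x); rewrite ?csize_cons; lia.
Qed.

Lemma computable_has (A X : coded) (g : A -> X -> bool) (f : A -> seq X) :
  computable b (fun t => g t.1 t.2) -> computable b f ->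
  computable b (fun a => has (g a) (f a)).
Proof.
move=> cg cf.
apply: (@computable_ext _ _ _
  (fun a => foldr (fun x y => if g a x then true else y) false (f a))).
  by move=> a; elim: (f a) => //= x s ->.
apply: (@computable_foldr b _ _ _ f (fun=> false)
  (fun a x y => if g a x then true else y)) => //.
- by apply: computable_if; [apply: (computable_comp2 cg) | |]; computability.
- exact: computable_false.
exists (fun=> 3); first exact: bound_const.
by move=> a y x; case: (g a x); have := csize_bool true; lia.
Qed.

Lemma computable_flatten (A X : coded) (f : A -> seq (seq X)) :
  computable b f -> computable b (fun a => flatten (f a)).
Proof.
move=> cf; rewrite /flatten.
apply: (@computable_foldr b _ _ _ f (fun=> [::]) (fun _ => cat)) => //.
- by apply: computable_cat; computability.
- exact: computable_nil.
exists id; first exact: bound_id.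
move=> a y x; elim: x => [|x s]; rewrite /= ?csize_nil ?csize_cons; lia.
Qed.

Lemma computable_drop (A X Y : coded) (f : A -> seq X) (g : A -> seq Y) :
  computable b f -> computable b g ->
  computable b (fun a => drop (size (f a)) (g a)).
Proof.
move=> cf cg.
apply: (@computable_ext _ _ _
  (fun a => foldr (fun _ y => behead y) (g a) (f a))).
  move=> a; elim: (f a) => [|x s /= ->]; first by rewrite drop0.
  by rewrite -drop1 drop_drop.
apply: (@computable_foldr b _ _ _ f g (fun _ _ y => behead y)) => //.
  by computability.
exists id; first exact: bound_id.
by move=> a [|x0 y] x; rewrite /= ?csize_cons; lia.
Qed.

Lemma computable_all2 (A : coded) (r : rel bool) (f g : A -> seq bool) :
  computable b (fun t => r t.1 t.2) -> computable b f -> computable b g ->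
  computable b (fun a => all2 r (f a) (g a)).
Proof.
move=> cr cf cg.
pose step (_ : A) (y : bool * seq bool) x :=
  (y.1 && (~~ nilp y.2 && r x (head false y.2)), behead y.2).
apply: (@computable_ext _ _ _ (fun a =>
    let y := foldl (step a) (true, g a) (f a) in y.1 && nilp y.2)).
  move=> a /=; rewrite -[RHS]andTb.
  elim: (f a) true (g a) => [|x s IH] o t; first by case: t.
  case: t => [|x' t] /=; rewrite IH; last by rewrite /= andbA.
  by rewrite !andbF; case: (s) => [|? []].
apply: (@computable_comp _ _ _ _ (fun y : bool * seq bool => y.1 && nilp y.2)).
  by apply: computable_and; computability.
apply: (@computable_foldl b _ _ _ f (fun a => (true, g a)) step) => //;
  last 1 first.
- exists (fun=> 3); first exact: bound_const.
  move=> a [o y] x; rewrite /step !csize_pair /=.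
  move: (o && _) => o'; have := csize_bool o'; have := csize_bool o.
  by case: y => [|x0 y]; rewrite /= ?csize_cons; lia.
- apply: computable_pair; last by computability.
  apply: computable_and; first by computability.
  apply: computable_and; first by apply: computable_neg; computability.
  by apply: (computable_comp2 cr); computability.
by computability.
Qed.

Lemma computable_eq (A : coded) (f g : A -> seq bool) :
  computable b f -> computable b g -> computable b (fun a => f a == g a).
Proof.
move=> cf cg; apply: (@computable_ext _ _ _ (fun a => all2 eq_op (f a) (g a))).
  by move=> a; rewrite -eqseq_all.
apply: computable_all2 => //.
apply: (@computable_ext _ _ _ (fun t : bool * bool => if t.1 then t.2 else ~~ t.2)).
  by case=> [[] []].
by apply: computable_if; [| |apply: computable_neg]; computability.
Qed.

Lemma computable_mem (A : coded) (f : A -> seq bool) (g : A -> seq (seq bool)) :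
  computable b f -> computable b g -> computable b (fun a => f a \in g a).
Proof.
move=> cf cg.
apply: (@computable_ext _ _ _ (fun a => has (fun x => f a == x) (g a))).
  by move=> a; elim: (g a) => //= x s ->; rewrite inE.
apply: computable_has => //; apply: computable_eq; last by computability.
by apply: (computable_comp cf); computability.
Qed.

End Lists.

(** * The program *)

Ltac computable_step ::= first
  [ apply computable_neg | apply computable_and | apply computable_imp
  | apply computable_cat | apply computable_flatten | apply computable_map
  | apply computable_filter | apply computable_has | apply computable_drop
  | apply computable_eq | apply computable_mem | apply computable_all2
  | apply computable_option ].

Section Support.
Variable T : eqType.
Implicit Types (x : T) (s t C : seq T) (F : seq (seq T)) (m : seq bool).

Definition adjoin x s := if x \in s then s else x :: s.

Definition merge_seq s t := foldr adjoin t s.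

Definition support s t F := merge_seq s (merge_seq t (foldr merge_seq [::] F)).

Definition charmask C s := [seq w \in s | w <- C].

Definition unmask C m :=
  (foldl (fun y x => (if head false y.2 then x :: y.1 else y.1, behead y.2))
         ([::], m) C).1.

Lemma mem_merge_seq s t : merge_seq s t =i s ++ t.
Proof.
move=> x; elim: s => //= y s IH; rewrite /adjoin inE -IH.
case: ifP => [ys|_]; last by rewrite inE.
by case: eqP => [->|].
Qed.

Lemma merge_seq_uniq s t : uniq t -> uniq (merge_seq s t).
Proof.
by move=> ut; elim: s => //= x s IH; rewrite /adjoin; case: ifP => //= ->.
Qed.

Lemma mem_support s t F : support s t F =i s ++ t ++ flatten F.
Proof.
move=> x; rewrite mem_merge_seq !mem_cat mem_merge_seq mem_cat.
by congr [|| _, _ | _]; elim: F => //= f F IH; rewrite mem_merge_seq !mem_cat IH.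
Qed.

Lemma support_uniq s t F : uniq (support s t F).
Proof.
by do 2!apply: merge_seq_uniq; case: F => //= f F; apply: merge_seq_uniq;
   elim: F => //= g F; apply: merge_seq_uniq.
Qed.

Lemma size_support s t F k :
  size s <= k -> size t <= k -> (forall f, f \in F -> size f <= k) ->
  size (support s t F) <= k * (size F).+2.
Proof.
move=> ss st sF; rewrite (leq_trans (uniq_leq_size (support_uniq s t F) _)
  (_ : size (s ++ t ++ flatten F) <= _)) //.
  by move=> x; rewrite mem_support.
rewrite !size_cat !mulnS !leq_add //.
elim: F sF => //= f F IH sF; rewrite size_cat mulnS leq_add ?sF ?mem_head //.
by apply: IH => g gF; rewrite sF // inE gF orbT.
Qed.

Lemma unmaskE C m : unmask C m = rev (mask m C).
Proof.
rewrite /unmask -[RHS]cats0; move: [::] => o; elim: C o m => [|x C IH] o [|a m] //=.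
by case: a; rewrite IH // rev_cons cat_rcons.
Qed.

End Support.

(* If [w] has more than [size C] digits, then its value is at least 2 ^ size C,
   as is that of [ones]: neither bounds the length of a shortest walk. *)
Definition cap (C : seq word) (l : option word) : word :=
  let ones := true :: [seq true | _ <- C] in
  if l is Some w then if nilp (drop (size w) ones) then ones else w else ones.

Definition inputs : Type :=
  ((word * word * seq word * seq word * option word) * seq (seq word))%type.

Definition reduced : Type :=
  (word * seq word * (word * word) * word)%type.

Definition reduce_over (x : inputs) (C : seq word) : reduced * seq word :=
  (x.1.1.1.1.2, [seq charmask C f | f <- x.2],
   (charmask C x.1.1.1.2, charmask C x.1.1.2), cap C x.1.2, C).

Definition reduce (x : inputs) :=
  reduce_over x (support x.1.1.1.2 x.1.1.2 x.2).

Lemma computable_merge_seq b (A : coded) (f g : A -> seq word) :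
  computable b f -> computable b g -> computable b (fun a => merge_seq (f a) (g a)).
Proof.
move=> cf cg.
apply: (@computable_foldr b _ _ _ f g (fun _ => @adjoin _)) => //.
  by rewrite /adjoin; computability.
exists (fun s => s + 1); first by apply: bound_addn; apply: bound_id.
by move=> a y x; rewrite /adjoin; case: ifP; rewrite ?csize_cons; lia.
Qed.

Lemma computable_support b (A : coded) (f g : A -> seq word)
    (h : A -> seq (seq word)) :
  computable b f -> computable b g -> computable b h ->
  computable b (fun a => support (f a) (g a) (h a)).
Proof.
move=> cf cg ch; do 2!apply: computable_merge_seq => //.
apply: (@computable_foldr b _ _ _ h (fun=> [::]) (fun _ => @merge_seq _)) => //.
- by apply: computable_merge_seq; computability.
- by computability.
exists id; first exact: bound_id.
move=> a y x; elim: x => [|x s]; rewrite /= ?csize_nil ?csize_cons; first lia.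
by rewrite {1}/adjoin; case: ifP; rewrite ?csize_cons; lia.
Qed.

Lemma computable_charmask b (A : coded) (f g : A -> seq word) :
  computable b f -> computable b g -> computable b (fun a => charmask (f a) (g a)).
Proof.
move=> cf cg.
apply: (@computable_map _ A (seq_coded bool_coded) _ (fun a w => w \in g a) f) => //.
apply: computable_mem; first by computability.
by apply: (computable_comp cg); computability.
Qed.

Lemma computable_reduce b : computable b reduce.
Proof.
apply: (@computable_comp b _ _ _ (fun t : inputs * seq word => reduce_over t.1 t.2)
   (fun x : inputs => (x, support x.1.1.1.2 x.1.1.2 x.2))).
  rewrite /reduce_over /cap; computability; try apply: computable_charmask; computability.
  apply: (@computable_map _ _ (seq_coded (seq_coded bool_coded)) _
    (fun t : inputs * seq word => charmask t.2) (fun t => t.1.2)); last by computability.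
  by apply: computable_charmask; computability.
by apply: computable_pair; [|apply: computable_support]; computability.
Qed.

Definition unary (w : word) : seq bool :=
  foldr (fun x u => if x then true :: u ++ u else u ++ u) [::] w.

Definition feasible (e : word * seq word) (m : word) : bool :=
  nilp (drop (size (unary e.1)) [seq x <- m | x]) &&
  has (fun f => all2 implb f m) e.2.

Definition flips (m : word) : seq word :=
  (foldr (fun x y => (x :: y.1, (~~ x :: y.1) :: map (cons x) y.2))
         ([::], [::]) m).2.

Definition extend e (p : seq word) : seq (seq word) :=
  [seq m :: p | m <- [seq m <- flips (head [::] p) | feasible e m]].

Definition level e (ps : seq (seq word)) : seq (seq word) :=
  flatten [seq extend e p | p <- ps].

Definition reaching (s : word) (ps : seq (seq word)) : option (seq word) :=
  foldr (fun p o => if head [::] p == s then Some p else o) None ps.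

Definition search_state : Type := (option (seq word) * seq (seq word))%type.

Definition search_in (s : word) (ps : seq (seq word)) : search_state :=
  (reaching s ps, ps).

Definition search_step e s (y : search_state) : search_state :=
  if y.1 is Some _ then y else search_in s (level e y.2).

(* Walks are prolonged at their head, starting from the target [t]; hence they
   are listed from [s] to [t]. *)
Definition search e s t (u : seq bool) : search_state :=
  foldl (fun y _ => search_step e s y) (search_in s [:: [:: t]]) u.

Definition solve (r : reduced) : option (seq word) :=
  (search r.1.1 r.1.2.1 r.1.2.2 (unary r.2)).1.

Definition decode (x : option (seq word) * seq word) :
    option (seq (seq word)) :=
  if x.1 is Some p then Some [seq unmask x.2 m | m <- p] else None.

Lemma computable_head_nil b (X : coded) : computable b (head ([::] : seq X)).
Proof. exact: computable_head. Qed.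

Lemma computable_unary (A : coded) (f : A -> word) :
  computable false f -> computable false (fun a => unary (f a)).
Proof.
move=> cf.
apply: (@computable_foldr _ A bool_coded (seq_coded bool_coded) f (fun=> [::])
  (fun _ x u => if x then true :: u ++ u else u ++ u)) => //; by computability.
Qed.

Lemma computable_feasible (A : coded) (e : A -> word * seq word) (m : A -> word) :
  computable false e -> computable false m ->
  computable false (fun a => feasible (e a) (m a)).
Proof.
move=> ce cm; apply: computable_and.
  apply: (computable_comp (computable_nilp _ _)).
  apply: computable_drop; first by apply: computable_unary; computability.
  by apply: (@computable_filter _ _ bool_coded (fun _ x => x)); computability.
apply: (@computable_has _ A (seq_coded bool_coded)
  (fun a f => all2 implb f (m a)) (fun a => (e a).2)); last by computability.
apply: computable_all2; first by apply: computable_imp; computability.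
  by computability.
by apply: (computable_comp cm); computability.
Qed.

Lemma computable_flips (A : coded) (m : A -> word) :
  computable false m -> computable false (fun a => flips (m a)).
Proof.
move=> cm; apply: (computable_comp (computable_snd _ _ _)).
apply: (@computable_foldr _ A bool_coded
  (pair_coded (seq_coded bool_coded) (seq_coded (seq_coded bool_coded))) m
  (fun=> ([::], [::]))
  (fun _ x y => (x :: y.1, (~~ x :: y.1) :: map (cons x) y.2))) => //.
  computability.
by computability.
Qed.

Lemma computable_level (A : coded) (e : A -> word * seq word)
    (ps : A -> seq (seq word)) :
  computable false e -> computable false ps ->
  computable false (fun a => level (e a) (ps a)).
Proof.
move=> ce cps; apply: computable_flatten.
apply: (@computable_map _ A (seq_coded (seq_coded bool_coded)) _
  (fun a => extend (e a)) ps) => //.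
apply: (@computable_map _ (pair_coded A (seq_coded (seq_coded bool_coded)))
  (seq_coded bool_coded) _ (fun t m => m :: t.2)
  (fun t => [seq m <- flips (head [::] t.2) | feasible (e t.1) m])).
  by computability.
apply: (@computable_filter _ (pair_coded A (seq_coded (seq_coded bool_coded)))
  (seq_coded bool_coded) (fun t => feasible (e t.1))).
  by apply: computable_feasible; [apply: (computable_comp ce)|]; computability.
apply: computable_flips.
by apply: (computable_comp (computable_head_nil _ bool_coded)); computability.
Qed.

Lemma computable_reaching (A : coded) (s : A -> word) (ps : A -> seq (seq word)) :
  computable false s -> computable false ps ->
  computable false (fun a => reaching (s a) (ps a)).
Proof.
move=> cs cps.
apply: (@computable_foldr _ A (seq_coded (seq_coded bool_coded)) _ ps (fun=> None)
  (fun a p o => if head [::] p == s a then Some p else o)) => //.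
  apply: computable_if; try by computability.
  apply: computable_eq; last by apply: (computable_comp cs); computability.
  by apply: (computable_comp (computable_head_nil _ bool_coded)); computability.
by computability.
Qed.

Lemma computable_search_in (A : coded) (s : A -> word) (ps : A -> seq (seq word)) :
  computable false s -> computable false ps ->
  computable false (fun a => search_in (s a) (ps a)).
Proof. by move=> cs cps; apply: computable_pair => //; apply: computable_reaching. Qed.

Lemma computable_solve : computable false solve.
Proof.
pose state := pair_coded (option_coded (seq_coded (seq_coded bool_coded)))
  (seq_coded (seq_coded (seq_coded bool_coded))).
apply: (computable_comp (computable_fst _ _ _)).
apply: (@computable_foldl _ _ bool_coded state (fun r : reduced => unary r.2)
  (fun r => search_in r.1.2.1 [:: [:: r.1.2.2]])
  (fun r y _ => search_step r.1.1 r.1.2.1 y)) => //.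
- apply: (@computable_option _ _ (seq_coded (seq_coded bool_coded)) state
    (fun t : reduced * (search_state * bool) => t.2.1.1) (fun t _ => t.2.1)
    (fun t => search_in t.1.1.2.1 (level t.1.1.1 t.2.1.2))); try by computability.
  by apply: computable_search_in; [|apply: computable_level]; computability.
- by apply: computable_unary; computability.
- by apply: computable_search_in; computability.
Qed.

Lemma computable_unmask (A : coded) (f : A -> seq word) (m : A -> word) :
  computable true f -> computable true m ->
  computable true (fun a => unmask (f a) (m a)).
Proof.
move=> cf cm; apply: (computable_comp (computable_fst _ _ _)).
apply: (@computable_foldl _ A (seq_coded bool_coded)
  (pair_coded (seq_coded (seq_coded bool_coded)) (seq_coded bool_coded)) f
  (fun a => ([::], m a))
  (fun _ y x => (if head false y.2 then x :: y.1 else y.1, behead y.2))) => //.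
- by computability.
- by computability.
exists (fun s => s + 1); first by apply: bound_addn; apply: bound_id.
move=> a [o [|x0 y]] x; rewrite !csize_pair /= ?csize_cons; first lia.
by case: x0; rewrite ?csize_cons; lia.
Qed.

Lemma computable_decode : computable true decode.
Proof.
apply: (@computable_option _ _ (seq_coded (seq_coded bool_coded)) _
  (fun x : option (seq word) * seq word => x.1)
  (fun x p => Some [seq unmask x.2 m | m <- p]) (fun=> None)); try by computability.
apply: computable_Some.
apply: (@computable_map _ _ (seq_coded bool_coded) (seq_coded (seq_coded bool_coded))
  (fun t : (option (seq word) * seq word) * seq word => unmask t.1.2));
  last by computability.
by apply: computable_unmask; computability.
Qed.

(** * Shortest walks on bit masks *)

Lemma size_unary_bits n : size (unary (bits n)) = n.
Proof.
rewrite /bits -[RHS]bin_of_natK; case: bin_of_nat => //= p.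
elim: p => //= p IH; rewrite size_cat ?IH /=; lia.
Qed.

Lemma size_bits_gt c n : c < size (bits n) -> 2 ^ c <= n.
Proof.
rewrite -{2}(bin_of_natK n) /bits; case: bin_of_nat => //= p.
suff H : 0 < nat_of_pos p /\ (forall c, c < size (bits_of_positive p) ->
  2 ^ c <= nat_of_pos p) by apply: H.2.
elim: p => [p [p0 IH]|p [p0 IH]|] /=; (split; first by lia);
  case=> [|d] //; rewrite ?expnS ?ltnS; (try move/IH); lia.
Qed.

Lemma size_unary_ones c : size (unary (nseq c true)) = (2 ^ c).-1.
Proof.
elim: c => //= c; rewrite size_cat expnS => ->.
by have := expn_gt0 2 c; lia.
Qed.

Variant cap_spec c (N : nat) : option nat -> Prop :=
  | CapBound : cap_spec c N (Some N)
  | CapFree lo : 2 ^ c <= N -> (forall l, lo = Some l -> 2 ^ c <= l) ->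
      cap_spec c N lo.

Lemma capP C lo : cap_spec (size C) (size (unary (cap C (omap bits lo)))) lo.
Proof.
have onesE : true :: [seq true | _ <- C] = nseq (size C).+1 true.
  by congr (_ :: _); elim: C => //= _ C ->.
have ones_ge : 2 ^ size C <= size (unary (true :: [seq true | _ <- C])).
  by rewrite onesE size_unary_ones expnS; have := expn_gt0 2 (size C); lia.
case: lo => [l|]; last by apply: CapFree.
rewrite /cap /=; set d := drop _ _; case: (boolP (nilp d)) => Hd.
  apply: CapFree => // _ [<-]; apply: size_bits_gt.
  by move: Hd; rewrite /d onesE /nilp size_drop size_nseq; lia.
by rewrite size_unary_bits; apply: CapBound.
Qed.

Lemma flips_cons x m : flips (x :: m) = (~~ x :: m) :: map (cons x) (flips m).
Proof.
by rewrite {1}/flips /=; set y := foldr _ _ _; have -> : y.1 = m by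
  rewrite /y; elim: (m) => //= ? ? ->.
Qed.

Lemma size_flips m m' : m' \in flips m -> size m' = size m.
Proof.
elim: m m' => [|x m IH] m' //; rewrite flips_cons inE => /predU1P[-> //|].
by case/mapP => m2 /IH /= <- ->.
Qed.

Section Walks.
Variables (e : word * seq word) (s t : word).

Let adj : rel word := fun m m' => m \in flips m'.

Definition walk (p : seq word) : bool :=
  [&& last [::] p == t, all (feasible e) p & sorted adj p].

Let walks n := iter n (level e) [:: [:: t]].

Lemma mem_walks n p :
  feasible e t -> (p \in walks n) = (size p == n.+1) && walk p.
Proof.
move=> ft; elim: n p => [|n IH] p.
  rewrite /walks /= inE /walk; case: p => [|m [|m' p]] //=.
    by rewrite eqseq_cons eqxx !andbT; case: eqP => //= ->; rewrite ft.
  by rewrite eqseq_cons andbF.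
rewrite /walks iterS -/(walks n) /level.
apply/flatten_mapP/idP => [[q]|].
  rewrite IH => /andP[/eqP sq /and3P[lq aq oq]] /mapP[m].
  rewrite mem_filter => /andP[fm mq] -> /=.
  by case: q sq lq aq oq mq => //= m' q [->] lq aq oq mq;
  rewrite eqxx /walk /= lq aq fm /adj mq.
case: p => [|m [|m' q]] // /andP[/eqP[sq]]; rewrite /walk /=.
case/and3P=> lq /andP[fm aq] /andP[mq oq].
exists (m' :: q); first by rewrite IH /walk /= sq eqxx lq aq.
by apply: map_f; rewrite mem_filter fm.
Qed.

Lemma reachingP ps :
  if reaching s ps is Some p then p \in ps /\ head [::] p = s
  else forall p, p \in ps -> head [::] p != s.
Proof.
elim: ps => //= p ps IH; case: eqP => [->|/eqP ps_neq]; first by rewrite mem_head.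
case: reaching IH => [q [qs ->]|IH q]; first by rewrite inE qs orbT.
by rewrite inE => /predU1P[->|/IH].
Qed.

Lemma search_spec u :
  if (search e s t u).1 is Some p then
    exists2 n, n <= size u &
      [/\ p \in walks n, head [::] p = s &
          forall j q, j < n -> q \in walks j -> head [::] q != s]
  else (search e s t u).2 = walks (size u) /\
       forall j q, j <= size u -> q \in walks j -> head [::] q != s.
Proof.
rewrite /search; elim/last_ind: u => [|u x].
  have := reachingP [:: [:: t]]; rewrite /=.
  set r := if _ then _ else _; case: r => [p [ps hp]|H].
    by exists 0.
  by split=> // j q; rewrite leqn0 => /eqP ->; apply: H.
rewrite foldl_rcons size_rcons; set y := foldl _ _ u.
rewrite /search_step; case y1: y.1 => [p|].
  by rewrite y1 => -[n le_n H]; exists n => //; apply: leqW.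
case=> -> H /=; have := reachingP (level e (walks (size u))).
rewrite -/(walks (size u).+1); case: reaching => [p [ps hp]|H'].
  by exists (size u).+1.
split=> // j q; rewrite leq_eqVlt => /predU1P[->|]; first exact: H'.
by rewrite ltnS; apply: H.
Qed.

Lemma uniq_masks_size c (p : seq word) :
  uniq p -> (forall m, m \in p -> size m = c) -> size p <= 2 ^ c.
Proof.
move=> up sp; rewrite -card_bool -(card_tuple c) cardE -(size_map val).
apply: uniq_leq_size => // m /sp sm.
by apply/mapP; exists (Tuple (introT eqP sm)); rewrite ?mem_enum.
Qed.

Lemma size_walk p m : walk p -> m \in p -> size m = size t.
Proof.
case/and3P=> /eqP <- _; elim: p m => // m0 [|m1 p] IH m /=.
  by rewrite inE => _ /eqP ->.
case/andP=> /size_flips m01 /= pp; rewrite inE => /predU1P[->|].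
  by rewrite m01; apply: (IH m1 pp); rewrite mem_head.
exact: (IH m pp).
Qed.

Lemma shorten_walk p : walk p -> p != [::] ->
  exists q, [/\ walk q, head [::] q = head [::] p & 0 < size q <= 2 ^ size t].
Proof.
case: p => // m p wp _; have /and3P[lp ap sp] := wp.
move: lp => /=; case/shortenP: (sp : path adj m p) => q pq uq sub lq.
have wq : walk (m :: q).
  rewrite /walk /= lq; move: ap => /= /andP[-> /allP ap].
  by rewrite pq andbT; apply/allP => x /sub /ap.
exists (m :: q); split=> //=.
by apply: uniq_masks_size (m :: q) uq _ => x; apply: size_walk.
Qed.

Hypothesis feasible_t : feasible e t.

Lemma search_sound u p : (search e s t u).1 = Some p ->
  [/\ walk p, head [::] p = s, 0 < size p <= (size u).+1,
      size p <= 2 ^ size t &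
      forall q, walk q -> head [::] q = s -> 0 < size q -> size p <= size q].
Proof.
move=> E; have := search_spec u; rewrite E => -[n le_n].
rewrite mem_walks // => -[/andP[/eqP sp wp] hp H].
have H' q : walk q -> head [::] q = s -> 0 < size q -> size p <= size q.
  move=> wq /eqP hq q0; rewrite sp leqNgt; apply/negP => lt_q.
  have := H (size q).-1 q; rewrite mem_walks // prednK // eqxx wq hq.
  by move/(_ lt_q isT).
split=> //; rewrite ?sp //.
have [|q [wq hq /andP[q0 sq]]] := shorten_walk wp; first by case: (p) sp.
by rewrite -sp (leq_trans (H' q wq _ q0)) // hq.
Qed.

Lemma search_complete u q : (search e s t u).1 = None ->
  walk q -> head [::] q = s -> 0 < size q -> (size u).+1 < size q.
Proof.
move=> E wq /eqP hq q0; have := search_spec u; rewrite E => -[_ H].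
rewrite ltnNge; apply/negP => le_q; have := H (size q).-1 q.
rewrite mem_walks // prednK // eqxx wq hq -ltnS prednK //.
by move/(_ le_q isT).
Qed.

Lemma search_complete_all u q : (search e s t u).1 = None ->
  2 ^ size t <= size u -> walk q -> head [::] q = s -> q = [::].
Proof.
move=> E le_u wq hq; apply/eqP/negPn/negP => q0.
have [q' [wq' hq' /andP[q'0 sq']]] := shorten_walk wq q0.
have := search_complete E wq' (etrans hq' hq) q'0; lia.
Qed.

End Walks.

(** * Bit masks and sets *)

Local Open Scope fset_scope.
Local Open Scope nat_scope.

Lemma flips_mapP (T : eqType) (cs : seq T) (P R : pred T) :
  uniq cs ->
  reflect (exists2 x, x \in cs &
             R x = ~~ P x /\ {in cs, forall y, y != x -> R y = P y})
          (map R cs \in flips (map P cs)).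
Proof.
elim: cs => [|c cs IH] /=; first by right; case.
case/andP=> c_cs /IH {}IH; rewrite flips_cons inE eqseq_cons.
apply: (iffP orP) => [[/andP[/eqP Rc /eqP E]|]|[x]].
- exists c; first exact: mem_head.
  split=> // y; rewrite inE => /predU1P[->|]; first by rewrite eqxx.
  by move/eq_in_map: E => E /E.
- case/mapP=> m m_in [Rc Em]; rewrite -Em in m_in.
  have [x x_cs [Rx H]] := IH m_in.
  exists x; first by rewrite inE x_cs orbT.
  by split=> // y; rewrite inE => /predU1P[->|]; [rewrite Rc | apply: H].
rewrite inE => /predU1P[->|x_cs] [Rx H].
  left; rewrite Rx eqxx /=; apply/eqP/eq_in_map => y y_cs.
  apply: H; first by rewrite inE y_cs orbT.
  by apply: contraNneq c_cs => <-.
right; have Rc : R c = P c.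
  apply: H; first exact: mem_head.
  by apply: contraNneq c_cs => ->.
rewrite Rc; apply: map_f; apply/IH; exists x => //; split=> // y y_cs.
by apply: H; rewrite inE y_cs orbT.
Qed.

Lemma one_stepP (T : choiceType) (A B : {fset T}) :
  one_step A B <->
  exists x, (x \in B) = (x \notin A) /\ (forall y, y != x -> (y \in B) = (y \in A)).
Proof.
split=> [[[x xA ->]|[x xA ->]]|[x [xB H]]].
- exists x; rewrite !inE eqxx xA; split=> // y /negPf yx.
  by rewrite !inE yx.
- exists x; rewrite !inE eqxx xA; split=> // y yx.
  by rewrite !inE yx.
case: (boolP (x \in A)) xB => xA xB; [right | left]; exists x => //.
  by apply/fsetP => y; rewrite !inE; case: eqVneq => [->|/H].
by apply/fsetP => y; rewrite !inE; case: eqVneq => [->|/H].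
Qed.

Section Masks.
Variables (T : choiceType) (cs : seq T).
Hypothesis cs_uniq : uniq cs.

Definition mask_of (A : {fset T}) : seq bool := [seq x \in A | x <- cs].

Definition set_of (m : seq bool) : {fset T} := [fset x in mask m cs].

Lemma in_set_of m x : (x \in set_of m) = (x \in mask m cs).
Proof. by rewrite inE. Qed.

Lemma size_mask_of A : size (mask_of A) = size cs.
Proof. exact: size_map. Qed.

Lemma mask_ofK (A : {fset T}) : {subset A <= cs} -> set_of (mask_of A) = A.
Proof.
move=> sub; apply/fsetP => x; rewrite in_set_of -filter_mask mem_filter.
by apply: andb_idr; apply: sub.
Qed.

Lemma set_ofK m : size m = size cs -> mask_of (set_of m) = m.
Proof.
move=> sm; rewrite /mask_of (eq_map (in_set_of m)).
elim: cs m cs_uniq sm => [|c s IH] [|b m] //= /andP[cs' us] [sm].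
congr (_ :: _).
  by case: b; rewrite ?mem_head //; apply/negP => /mem_mask; apply/negP.
rewrite -[RHS](IH m us sm); apply/eq_in_map => x xs.
case: b => //; rewrite inE; case: eqVneq => // xc.
by rewrite -xc xs in cs'.
Qed.

Lemma set_of_sub m : {subset set_of m <= cs}.
Proof. by move=> x; rewrite in_set_of => /mem_mask. Qed.

Lemma card_set_of_mask (A : {fset T}) : size [seq b <- mask_of A | b] <= #|` A|.
Proof.
rewrite size_filter count_map -size_filter.
by apply: uniq_leq_size; [apply: filter_uniq | move=> x; rewrite mem_filter => /andP[]].
Qed.

Lemma card_set_of m : size m = size cs -> #|` set_of m| = size [seq b <- m | b].
Proof.
by move=> sm; rewrite card_fseq undup_id ?mask_uniq // size_mask // size_filter.
Qed.

Lemma mask_of_step (A B : {fset T}) :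
  one_step A B -> mask_of A = mask_of B \/ mask_of A \in flips (mask_of B).
Proof.
case/one_stepP=> x [xB H]; case: (boolP (x \in cs)) => x_cs; [right | left].
  apply/flips_mapP => //; exists x => //; split=> [|y _ /H ->] //.
  by rewrite xB negbK.
apply/eq_in_map => y y_cs; rewrite H //.
by apply: contraNneq x_cs => <-.
Qed.

Lemma set_of_step m m' :
  size m' = size cs -> m \in flips m' -> one_step (set_of m) (set_of m').
Proof.
move=> sm' mm'; have sm := size_flips mm'; rewrite sm' in sm.
move: mm'; rewrite -{1}(set_ofK sm) -{1}(set_ofK sm').
case/flips_mapP=> // x x_cs [xm H]; apply/one_stepP; exists x.
split=> [|y yx]; first by rewrite xm negbK.
have [y_cs|y_cs] := boolP (y \in cs); first by rewrite H.
by rewrite (negPf (contra (@set_of_sub m y) y_cs))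
  (negPf (contra (@set_of_sub m' y) y_cs)).
Qed.

Lemma all2_implb (A B : {fset T}) :
  {subset A <= cs} -> all2 implb (mask_of A) (mask_of B) = (A `<=` B).
Proof.
move=> sub; rewrite /mask_of.
have -> : all2 implb [seq x \in A | x <- cs] [seq x \in B | x <- cs] =
  all (fun x => (x \in A) ==> (x \in B)) cs by elim: (cs) => //= c s ->.
apply/allP/fsubsetP => [H x xA|AB x _]; first exact: implyP (H x (sub x xA)) xA.
by apply/implyP; apply: AB.
Qed.

End Masks.

Section Reconfiguration.
Variables (Q : subset_problem) (a : endpoints Q) (F : {fset {fset elt Q}}).
Hypothesis sup : superset_closed Q.
Let I := ep_inst a.
Let k := ep_k a.
Let S := ep_S a.
Let T := ep_T a.
Hypothesis minF : is_minimal_family I k F.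

Variable cs : seq (elt Q).
Hypothesis cs_uniq : uniq cs.
Hypotheses (subS : {subset S <= cs}) (subT : {subset T <= cs}).
Hypothesis subF : forall f, f \in F -> {subset f <= cs}.
Hypothesis cs_dom : {subset cs <= dom I}.

Variable e : word * seq word.
Hypothesis e_k : size (unary e.1) = k.
Hypothesis e_F : e.2 =i [seq mask_of cs f | f <- F].

Lemma sol_minimal A : sol I k A -> exists2 f, f \in F & f `<=` A.
Proof.
move=> solA; suff /hasP[f] : has (fun f => f `<=` A) F by exists f.
apply/negPn/negP => /hasPn noF.
suff H n B : #|` B| < n -> B `<=` A -> ~ sol I k B.
  exact: H #|` A|.+1 A (ltnSn _) (fsubset_refl _) solA.
elim: n B => // n IH B; rewrite ltnS => leB BA solB.
have /noF/negP[] : B \in F; last by [].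
apply/minF; split=> // B' solB' B'B.
apply: IH solB'; first exact: leq_trans (fproper_ltn_card B'B) leB.
exact: fsubset_trans (fproper_sub B'B) BA.
Qed.

Lemma feasible_mask A :
  feasible e (mask_of cs A) =
  (size [seq b <- mask_of cs A | b] <= k) && has (fun f => f `<=` A) F.
Proof.
rewrite /feasible /nilp size_drop e_k subn_eq0; congr (_ && _).
rewrite (eq_has_r e_F) has_map; apply: eq_in_has => f /= fF.
by rewrite all2_implb //; apply: subF.
Qed.

Lemma feasible_of_sol A : sol I k A -> feasible e (mask_of cs A).
Proof.
move=> solA; have le_k := leq_trans (card_set_of_mask cs_uniq A) (sol_card solA).
rewrite feasible_mask le_k /=.
by have [f fF fA] := sol_minimal solA; apply/hasP; exists f.
Qed.

Lemma sol_of_feasible m : size m = size cs -> feasible e m -> sol I k (set_of cs m).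
Proof.
move=> sm; rewrite -{1}(set_ofK cs_uniq sm) feasible_mask.
rewrite set_ofK // -(card_set_of cs_uniq sm) => /andP[le_k /hasP[f /minF[solf _] fm]].
by apply: (sup solf fm _ le_k) => x /set_of_sub/cs_dom.
Qed.

Let s := mask_of cs S.
Let t := mask_of cs T.

Lemma reconf_of_walk n p :
  size p = n.+1 -> walk e t p -> head [::] p = s ->
  ep_reconf a n [seq set_of cs m | m <- p].
Proof.
move=> sp wp hp; have /and3P[/eqP lp /allP ap /(sortedP [::]) op] := wp.
have sz i : i <= n -> size (nth [::] p i) = size cs.
  move=> le_i; rewrite -(size_mask_of cs T).
  by apply: size_walk wp _; rewrite mem_nth // sp.
have nthE i : i <= n -> nth fset0 [seq set_of cs m | m <- p] i = set_of cs (nth [::] p i).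
  by move=> le_i; rewrite (nth_map [::]) // sp.
split.
- by rewrite size_map.
- by rewrite nthE // nth0 hp mask_ofK.
- by rewrite nthE // -[n]/(n.+1.-1) -sp nth_last lp mask_ofK.
- by move=> i le_i; rewrite nthE //; apply: sol_of_feasible;
    [apply: sz | apply: ap; rewrite mem_nth // sp].
move=> i lt_i; rewrite !nthE //; last exact: ltnW.
by apply: set_of_step => //; [apply: sz | apply: op; rewrite sp].
Qed.

Lemma walk_of_reconf n A U :
  reconf_seq I k A T n U ->
  exists p, [/\ walk e t p, head [::] p = mask_of cs A & 0 < size p <= n.+1].
Proof.
elim: n A U => [|n IH] A U [sU U0 Un solU stepU].
  exists [:: t]; rewrite -U0 Un; split=> //.
  by rewrite /walk /= eqxx andbT feasible_of_sol // -Un; apply: solU.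
case: U => [|A' U] //= in sU U0 Un solU stepU.
rewrite /= in U0; subst A'.
have [|p [wp hp /andP[p0 sp]]] := IH (nth fset0 U 0) U.
  case: sU => sU; split=> // i; first by move=> le_i; apply: (solU i.+1).
  by move=> lt_i; apply: (stepU i.+1).
have [E|fl] := mask_of_step cs_uniq (stepU 0 isT).
  by exists p; rewrite E -hp p0 ltnW.
exists (mask_of cs A :: p); split=> //.
have fA := feasible_of_sol (solU 0 isT).
case: p wp hp p0 sp => // m p /and3P[lp ap op] /= hp _ _.
by rewrite -hp in fl; apply/and3P; split; rewrite //= ?fA ?fl.
Qed.

Lemma search_shortest u p : (search e s t u).1 = Some p ->
  exists n, [/\ size p = n.+1, n <= size u, n < 2 ^ size cs &
    is_shortest a n [seq set_of cs m | m <- p]].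
Proof.
have ft : feasible e t by apply: feasible_of_sol; apply: ep_T_sol.
move=> /(search_sound ft)[wp hp /andP[p0 le_u] le_c minp].
exists (size p).-1; rewrite prednK // -ltnS prednK //.
rewrite size_mask_of in le_c; split=> //; split.
  by apply: reconf_of_walk; rewrite ?prednK.
move=> m U /walk_of_reconf[q [wq hq /andP[q0 sq]]].
by rewrite -ltnS prednK // (leq_trans (minp q wq hq q0)).
Qed.

Lemma search_none u n U : (search e s t u).1 = None -> ep_reconf a n U ->
  size u < n /\ size u < 2 ^ size cs.
Proof.
have ft : feasible e t by apply: feasible_of_sol; apply: ep_T_sol.
move=> E /walk_of_reconf[q [wq hq /andP[q0 sq]]].
split; first by have := search_complete ft E wq hq q0; lia.
rewrite ltnNge -(size_mask_of cs T); apply/negP => le_u.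
by have E' := search_complete_all ft E le_u wq hq; rewrite E' in q0.
Qed.

End Reconfiguration.

(** * Fixed-parameter tractability *)

Lemma rep_seq_enc (X : Type) (Y : coded) (c : X -> Y) (r : rep X) s t :
  (forall x u, r x u <-> u = enc (c x)) ->
  rep_seq r s t <-> t = enc [seq c x | x <- s].
Proof.
move=> rE; elim: s t => [|x s IH] t //=; split.
  by case=> u [v [-> /rE -> /IH ->]].
by move=> ->; exists (enc (c x)), (enc [seq c x | x <- s]); split=> //;
  [apply/rE | apply/IH].
Qed.

Lemma rep_wordE (w : word) t : rep_word w t <-> t = enc w.
Proof. by rewrite /rep_word (@rep_seq_enc _ bool_coded id) ?map_id // => -[] u. Qed.

Lemma rep_eltsE Q (s : seq (elt Q)) t :
  rep_seq (rep_elt Q) s t <-> t = enc [seq elt_code x | x <- s].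
Proof. by apply: (@rep_seq_enc _ (seq_coded bool_coded)) => x u; apply: rep_wordE. Qed.

Lemma rep_fset_elt Q (A : {fset elt Q}) t : rep_fset (rep_elt Q) A t ->
  exists s, [/\ uniq s, s =i A & t = enc [seq elt_code x | x <- s]].
Proof. by case=> s [us sA /rep_eltsE ->]; exists s. Qed.

Lemma rep_family Q (F : {fset {fset elt Q}}) t :
  rep_fset (rep_fset (rep_elt Q)) F t ->
  exists fs : seq (seq (elt Q)),
    [/\ t = enc [seq [seq elt_code x | x <- f] | f <- fs], all uniq fs,
        size fs = #|` F| & [seq [fset x in f] | f <- fs] =i F].
Proof.
case=> sF [usF sFF rF].
suff [fs [-> ufs E]] : exists fs : seq (seq (elt Q)),
    [/\ t = enc [seq [seq elt_code x | x <- f] | f <- fs], all uniq fs &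
        sF = [seq [fset x in f] | f <- fs]].
  exists fs; split=> //; last by rewrite -E.
  rewrite -(size_map (fun f : seq (elt Q) => [fset x in f])) -E.
  by apply/perm_size/uniq_perm; rewrite ?fset_uniq.
elim: sF t rF {usF sFF} => [|A sF IH] t /=; first by move=> ->; exists [::].
case=> u [v [-> /rep_fset_elt[s [us sA ->]] /IH[fs [-> ufs ->]]]].
exists (s :: fs); rewrite /= us; split=> //; congr (_ :: _).
by apply/fsetP => x; rewrite !inE sA.
Qed.

Lemma preimage_seq (X Y : eqType) (c : X -> Y) (s : seq Y) :
  (forall y, y \in s -> exists x, y = c x) -> exists s', s = map c s'.
Proof.
elim: s => [|y s IH] H; first by exists [::].
have [x ->] := H y (mem_head _ _).
have [|s' ->] := IH; last by exists (x :: s').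
by move=> z zs; apply: H; rewrite inE zs orbT.
Qed.

Lemma charmask_map (X Y : eqType) (c : X -> Y) (cs s : seq X) :
  injective c -> charmask (map c cs) (map c s) = [seq x \in s | x <- cs].
Proof.
by move=> c_inj; rewrite /charmask -map_comp; apply: eq_map => x /=; rewrite mem_map.
Qed.

Lemma size_cap C lo : size (cap C lo) <= (size C).+1.
Proof.
rewrite /cap; case: lo => [w|]; last by rewrite /= size_map.
by case: ifP => /=; rewrite ?size_map // /nilp size_drop /= size_map; lia.
Qed.

Lemma csize_seq_le (X : coded) B (s : seq X) :
  all (fun x => csize x <= B) s -> csize s <= size s * B.+1 + 1.
Proof.
elim: s => //= x s IH /andP[xB /IH]; rewrite csize_cons mulSn; lia.
Qed.

Lemma csize_word (w : word) L : size w <= L -> csize w <= L * 4 + 1.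
Proof.
move=> wL; apply: leq_trans (@csize_seq_le bool_coded 3 w _) _.
  by apply/allP => x _; case/andP: (csize_bool x).
by rewrite leq_add2r leq_mul2r wL.
Qed.

Definition within (lo : option nat) (m : nat) := if lo is Some l then m <= l else true.

Definition shortest_within Q (x : endpoints Q * option nat)
    (ans : option (seq {fset elt Q})) : Prop :=
  if ans is Some U then exists2 m, within x.2 m & is_shortest x.1 m U
  else forall m U, within x.2 m -> ~ ep_reconf x.1 m U.

Section Core.
Variable Q : subset_problem.
Hypothesis sup : superset_closed Q.
Variables (a : endpoints Q) (lo : option nat) (F : {fset {fset elt Q}}).
Hypothesis minF : is_minimal_family (ep_inst a) (ep_k a) F.
Variables (sS sT : seq (elt Q)) (fs : seq (seq (elt Q))).
Hypotheses (sSE : sS =i ep_S a) (sTE : sT =i ep_T a).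
Hypotheses (fsE : [seq [fset x in f] | f <- fs] =i F).

Let codes := map (@elt_code Q).

Definition input : inputs :=
  (inst_code (ep_inst a), bits (ep_k a), codes sS, codes sT, omap bits lo,
   map codes fs).

Lemma solve_correct : exists ans, shortest_within (a, lo) ans /\
  rep_answer Q ans (enc (decode (solve (reduce input).1, (reduce input).2))).
Proof.
rewrite /reduce /=; set C := support _ _ _.
have c_inj := @elt_code_inj Q.
have mem_codes_flatten w : w \in flatten (map codes fs) ->
    exists2 x, x \in flatten fs & w = elt_code x.
  by rewrite /codes -map_flatten => /mapP.
have [cs Ccs] : exists cs, C = map (@elt_code Q) cs.
  apply: preimage_seq => w; rewrite mem_support !mem_cat.
  by case/or3P => [/mapP[x _ ->]|/mapP[x _ ->]|/mem_codes_flatten[x _ ->]]; exists x.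
have cs_uniq : uniq cs by rewrite -(map_inj_uniq c_inj) -Ccs support_uniq.
have mem_cs : cs =i sS ++ sT ++ flatten fs.
  move=> x; rewrite -(mem_map c_inj) -Ccs mem_support.
  by rewrite /codes -map_flatten -!map_cat mem_map.
have F_fs f : f \in F -> exists2 f', f' \in fs & f = [fset x in f'].
  by rewrite -fsE => /mapP.
have subS : {subset ep_S a <= cs} by move=> x; rewrite mem_cs mem_cat sSE => ->.
have subT : {subset ep_T a <= cs}.
  by move=> x; rewrite mem_cs !mem_cat sTE => ->; rewrite orbT.
have subF f : f \in F -> {subset f <= cs}.
  case/F_fs=> f' f'fs -> x; rewrite !inE mem_cs !mem_cat => xf.
  by apply/orP; right; apply/orP; right; apply/flattenP; exists f'.
have cs_dom : {subset cs <= dom (ep_inst a)}.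
  move=> x; rewrite mem_cs !mem_cat => /or3P[|/[!sTE]|].
  - by rewrite sSE; apply: sol_dom (ep_S_sol a) x.
  - by apply: sol_dom (ep_T_sol a) x.
  case/flattenP=> f ffs xf.
  have : [fset x in f] \in F by rewrite -fsE map_f.
  by case/minF=> /sol_dom H _; apply: H; rewrite inE.
set e := (bits (ep_k a), [seq charmask C f | f <- map codes fs]).
have e_k : size (unary e.1) = ep_k a by apply: size_unary_bits.
have e_F : e.2 =i [seq mask_of cs f | f <- F].
  have -> : e.2 = [seq mask_of cs f | f <- [seq [fset x in f] | f <- fs]].
    rewrite /= -!map_comp Ccs; apply: eq_map => f /=.
    by rewrite charmask_map //; apply: eq_map => x; rewrite inE.
  by apply: eq_mem_map.
have sE : charmask C (codes sS) = mask_of cs (ep_S a).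
  by rewrite Ccs charmask_map //; apply: eq_map.
have tE : charmask C (codes sT) = mask_of cs (ep_T a).
  by rewrite Ccs charmask_map //; apply: eq_map.
rewrite /solve /= -/e sE tE; set u := unary _.
have cap_u : cap_spec (size cs) (size u) lo.
  by rewrite -(size_map (@elt_code Q)) -Ccs; apply: capP.
case E: (search _ _ _ _).1 => [p|]; rewrite /decode /=.
  have [n [sp le_u lt_c sh]] :=
    search_shortest sup minF cs_uniq subS subT subF cs_dom e_k e_F E.
  exists (Some [seq set_of cs m | m <- p]); split.
    exists n => //=; case: cap_u lt_c le_u => //= lo' _ H lt_c _.
    by case: lo' H => //= l /(_ l erefl); lia.
  exists (enc [seq unmask C m | m <- p]) => //.
  elim: p {E sp sh} => //= m p IH.
  eexists _, _; split=> //; exists (rev (mask m cs)).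
  split; first by rewrite rev_uniq mask_uniq.
    by move=> x; rewrite mem_rev in_set_of.
  by apply/rep_eltsE; rewrite unmaskE Ccs -map_mask map_rev.
exists None; split=> //= n U wn rU.
have [lt_u lt_c] :=
  search_none minF cs_uniq subF e_k e_F E rU.
case: cap_u wn lt_u lt_c => /=; first by lia.
by move=> lo' le_c _ _ _; rewrite ltnNge le_c.
Qed.

Hypotheses (sS_uniq : uniq sS) (sT_uniq : uniq sT) (fs_uniq : all uniq fs).

Definition reduced_size (h k : nat) :=
  let L := k * h.+2 in
  csize (bits k) + (h * (L * 4 + 1).+1 + 1) + 2 * (L * 4 + 1) + (L.+1 * 4 + 1) + 4.

Lemma reduced_size_le h : size fs <= h ->
  csize (reduce input).1 <= reduced_size h (ep_k a).
Proof.
move=> fs_h; rewrite /reduce /=; set C := support _ _ _; set k := ep_k a.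
have size_fset (s : seq (elt Q)) (A : {fset elt Q}) :
    uniq s -> s =i A -> sol (ep_inst a) k A -> size (codes s) <= k.
  move=> us sA /sol_card; rewrite size_map.
  by have -> : size s = #|` A| by apply/perm_size/uniq_perm; rewrite ?fset_uniq.
have CL : size C <= k * h.+2.
  apply: leq_trans (@size_support _ _ _ _ k _ _ _) _.
  - exact: size_fset sS_uniq sSE (ep_S_sol a).
  - exact: size_fset sT_uniq sTE (ep_T_sol a).
  - move=> _ /mapP[f ffs ->].
    have /minF[solf _] : [fset x in f] \in F by rewrite -fsE map_f.
    by apply: size_fset solf; [apply: (allP fs_uniq) | move=> x; rewrite inE].
  by rewrite leq_mul2l size_map !ltnS fs_h orbT.
have csize_charmask s : csize (charmask C s) <= k * h.+2 * 4 + 1.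
  by apply: csize_word; rewrite size_map.
rewrite /reduced_size /= !csize_pair /=.
have H1 := csize_charmask (codes sS); have H2 := csize_charmask (codes sT).
have H3 : csize [seq charmask C f | f <- map codes fs] <=
    h * (k * h.+2 * 4 + 1).+1 + 1.
  apply: leq_trans (@csize_seq_le (seq_coded bool_coded) (k * h.+2 * 4 + 1) _ _) _.
    by apply/allP => _ /mapP[f _ ->].
  by rewrite leq_add2r !size_map leq_mul2r fs_h orbT.
have H4 : csize (cap C (omap bits lo)) <= (k * h.+2).+1 * 4 + 1.
  by apply: csize_word; apply: leq_trans (size_cap _ _) _.
have arith x y1 y2 y3 y4 M N P : y1 <= M -> y2 <= M -> y3 <= N -> y4 <= P ->
  ((x + y3).+1 + (y1 + y2).+1).+1 + y4 < x + N + 2 * M + P + 4 by lia.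
exact: arith H1 H2 H3 H4.
Qed.

End Core.

Definition fpt_bound (T : nat -> nat -> nat) : Prop :=
  exists g c, forall k s, 0 < s -> T k s <= g k * s ^ c.

Lemma fpt_bound_par g : fpt_bound (fun k _ => g k).
Proof. by exists g, 0 => k s _; rewrite muln1. Qed.

Lemma fpt_bound_size : fpt_bound (fun _ s => s).
Proof. by exists (fun=> 1), 1 => k s _; rewrite mul1n. Qed.

Lemma fpt_bound_add T U :
  fpt_bound T -> fpt_bound U -> fpt_bound (fun k s => T k s + U k s).
Proof.
move=> [g [c Hc]] [h [d Hd]]; exists (fun k => g k + h k), (c + d) => k s s0.
rewrite mulnDl leq_add // ?(leq_trans (Hc k s s0)) ?(leq_trans (Hd k s s0)) //.
  by rewrite leq_mul2l leq_pexp2l ?leq_addr ?orbT.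
by rewrite leq_mul2l leq_pexp2l ?leq_addl ?orbT.
Qed.

Lemma fpt_bound_comp U T :
  bound true U -> fpt_bound T -> fpt_bound (fun k s => U (T k s)).
Proof.
move=> [mU pU] [g [c Hc]]; have [d Hd] := pU isT.
exists (fun k => d * (g k).+1 ^ d), (c * d) => k s s0.
apply: (@leq_trans (U ((g k).+1 * s ^ c))).
  by rewrite mU // (leq_trans (Hc k s s0)) // leq_mul2r leqnSn orbT.
rewrite (leq_trans (Hd _ _)) ?muln_gt0 ?expn_gt0 ?s0 //.
by rewrite expnMn -expnM mulnA.
Qed.

Lemma tsize_thead t : tsize (thead t) <= tsize t.
Proof.
by case: t => //= l r; rewrite -[tsize (Node _ _)]/(tsize l + tsize r).+1; lia.
Qed.

Lemma fpt_shortest_within Q :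
  superset_closed Q -> few_minimal_sols Q -> minimal_sols_fpt Q ->
  fpt (rep_pair (rep_endpoints Q) (rep_option rep_nat)) (rep_answer Q)
    (fun x => ep_k x.1) (@shortest_within Q).
Proof.
move=> sup [h few] [p0 [g0 [c0 H0]]].
have [p1 [T1 [bT1 H1]]] := computable_reduce true.
have [p2 [T2 [bT2 H2]]] := computable_solve.
have [p3 [T3 [bT3 H3]]] := computable_decode.
pose enum k s := 5 * s + 1 + g0 k * s ^ c0.
pose red k s := T1 (enum k s).
pose slv k s := 3 * red k s + T2 (reduced_size (h k) k).
have bound_enum : fpt_bound enum.
  apply: fpt_bound_add; last by exists g0, c0.
  apply: fpt_bound_add; last exact: (fpt_bound_par (fun=> 1)).
  by exists (fun=> 5), 1.
have bound_red : fpt_bound red by apply: fpt_bound_comp.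
have bound_slv : fpt_bound slv.
  apply: fpt_bound_add; last exact: fpt_bound_par.
  by do !apply: fpt_bound_add => //; apply: (fpt_bound_par (fun=> 0)).
have [g [c Hgc]] : fpt_bound (fun k s => enum k s + red k s + slv k s + T3 (slv k s)).
  by do !apply: fpt_bound_add => //; apply: fpt_bound_comp.
exists (PSeq (PCons PId (PSeq (PSeq PHead (PSeq PHead PHead)) p0))
         (PSeq p1 (PSeq (PCons (PSeq PHead p2) PTail) p3))), g, c.
move=> [a lo] _ [_ [ulo [-> /= [_ [uT [-> /= [_ [uS [-> /=
  [uI [uk [-> /= rI rk]]] rS]]] rT]]] rlo]]].
have [F [v [n [rF minF Ev le_n]]]] :=
  H0 (ep_inst a, ep_k a) _ (ex_intro _ uI (ex_intro _ uk (And3 erefl rI rk))).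
have [fs [vE ufs sfs fsE]] := rep_family rF.
have [sS [uniqS sSE uSE]] := rep_fset_elt rS.
have [sT [uniqT sTE uTE]] := rep_fset_elt rT.
have uloE : ulo = enc (omap bits lo).
  by case: lo rlo => [l [w -> /rep_wordE ->]|->].
set u := Node _ ulo.
pose x := input a lo sS sT fs.
have xE : Node u v = enc x.
  by move/rep_wordE: rI => uIE; move/rep_wordE: rk => ukE;
     rewrite /u uIE ukE uSE uTE uloE vE.
have [ans [ansP ans_rep]] := solve_correct sup lo minF sSE sTE fsE.
have [n1 E1 le_n1] := H1 x; have [n2 E2 le_n2] := H2 (reduce x).1.
have [n3 E3 le_n3] := H3 (solve (reduce x).1, (reduce x).2).
set y := (solve _, _) in E3 le_n3.
set s := tsize u.
have le_s1 := tsize_thead u; have le_s2 := tsize_thead (thead u).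
have le_s3 := tsize_thead (thead (thead u)).
have E0 := ECons (EId u) (ESeq (ESeq (EHead u) (ESeq (EHead _) (EHead _))) Ev).
have E4 : eval (PCons (PSeq PHead p2) PTail) (enc (reduce x)) (enc y) _ :=
  ECons (ESeq (EHead (enc (reduce x))) E2) (ETail (enc (reduce x))).
have le_n' : n <= g0 (ep_k a) * s ^ c0.
  apply: leq_trans le_n _; rewrite leq_mul2l; apply/orP; right.
  case: (c0) => // e; rewrite leq_exp2r //.
  exact: leq_trans le_s3 (leq_trans le_s2 le_s1).
have le_x : csize x <= enum (ep_k a) s.
  rewrite -xE -[tsize (Node u v)]/(s + tsize v).+1.
  by have := eval_size Ev; rewrite /enum; lia.
have le_red := leq_trans le_n1 (bT1.1 _ _ le_x).
have le_size : csize (reduce x).1 <= reduced_size (h (ep_k a)) (ep_k a).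
  apply: (reduced_size_le lo minF sSE sTE fsE uniqS uniqT ufs).
  have [F' minF' le_F'] := few (ep_inst a) (ep_k a).
  rewrite sfs; suff -> : F = F' by [].
  by apply/fsetP => f; apply/idP/idP => /[dup] _; [move/minF/minF' | move/minF'/minF].
have le_n2' := leq_trans le_n2 (bT2.1 _ _ le_size).
have le_E4 : csize (reduce x) + (csize (reduce x) + n2) + csize (reduce x)
    <= slv (ep_k a) s.
  have := eval_size E1; rewrite /slv /red; lia.
have le_n3' := leq_trans le_n3 (bT3.1 _ _ (leq_trans (eval_size E4) le_E4)).
exists ans; eexists; eexists; split; [exact: ans_rep | exact: ansP | |].
  rewrite xE in E0; exact: (ESeq E0 (ESeq E1 (ESeq E4 E3))).
apply: leq_trans (Hgc (ep_k a) s (tsize_gt0 _)).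
rewrite /enum /red -/s in le_s1 le_s2 *; lia.
Qed.

Lemma fpt_transfer (X X' Y Y' : Type) (rX : rep X) (rX' : rep X') (rY : rep Y)
    (rY' : rep Y') (par : X -> nat) (par' : X' -> nat) (R : X -> Y -> Prop)
    (R' : X' -> Y' -> Prop) (f : X -> X') (g : Y' -> Y) (p q : prog) (T U : nat -> nat) :
  bound true T -> bound true U ->
  (forall x u, rX x u ->
     exists u' n, [/\ rX' (f x) u', eval p u u' n & n <= T (tsize u)]) ->
  (forall y v, rY' y v ->
     exists v' n, [/\ rY (g y) v', eval q v v' n & n <= U (tsize v)]) ->
  (forall x, par' (f x) = par x) -> (forall x y, R' (f x) y -> R x (g y)) ->
  fpt rX' rY' par' R' -> fpt rX rY par R.
Proof.
move=> bT bU Hp Hq par_f RR' [r [h [c H]]].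
have [h' [c' Hb]] : fpt_bound (fun k s => T s + h k * T s ^ c + U (h k * T s ^ c)).
  have bTs : fpt_bound (fun _ s => T s) := fpt_bound_comp bT fpt_bound_size.
  have bh : fpt_bound (fun k s => h k * T s ^ c).
    have [h1 [c1 H1]] := bTs.
    exists (fun k => h k * h1 k ^ c), (c1 * c) => k s s0.
    rewrite -mulnA leq_mul2l expnM -expnMn; apply/orP; right.
    by case: (c) => // e; rewrite leq_exp2r // H1.
  by do !apply: fpt_bound_add => //; apply: fpt_bound_comp.
exists (PSeq p (PSeq r q)), h', c' => x u rxu.
have [u' [n [ru' En le_n]]] := Hp x u rxu.
have [y [v [m [ryv Rxy Em le_m]]]] := H _ _ ru'.
have [v' [l [rv' El le_l]]] := Hq y v ryv.
exists (g y), v', (n + (m + l)); split=> //; first exact: RR'.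
  exact: ESeq En (ESeq Em El).
apply: leq_trans (Hb _ _ (tsize_gt0 _)); rewrite -addnA leq_add //.
have le_m' : m <= h (par x) * T (tsize u) ^ c.
  apply: leq_trans le_m _; rewrite par_f leq_mul2l; apply/orP; right.
  by case: (c) => // e; rewrite leq_exp2r // (leq_trans (eval_size En)).
by rewrite leq_add // (leq_trans le_l) // bU.1 // (leq_trans (eval_size Em)).
Qed.

Lemma bound_linear c : bound true (fun s => c * s).
Proof. exact: bound_mul (bound_const _ _) (bound_id _). Qed.

Theorem theorem1 (Q : subset_problem) :
  superset_closed Q ->
  few_minimal_sols Q ->
  minimal_sols_fpt Q ->
  [/\ reconf_fpt Q,
      search_reconf_fpt Q,
      shortest_reconf_fpt Q
    & shortest_unbounded_reconf_fpt Q].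
Proof.
move=> sup few enum; have fptQ := fpt_shortest_within sup few enum.
have pre x u : rep_reconf_inst Q x u -> exists u' n,
    [/\ rep_pair (rep_endpoints Q) (rep_option rep_nat) (x.1, Some x.2) u',
        eval (PCons PHead (PCons PNil PTail)) u u' n & n <= 5 * tsize u].
  case=> v [w [-> rv rw]]; set t := Node v w.
  have E := ECons (EHead t) (ECons (ENil t) (ETail t)).
  exists (Node v (Node Leaf w)); eexists; split; [|exact: E|lia].
  by exists v, (Node Leaf w); split=> //; exists w.
have pre_free (x : endpoints Q) u : rep_endpoints Q x u -> exists u' n,
    [/\ rep_pair (rep_endpoints Q) (rep_option rep_nat) (x, None) u',
        eval (PCons PId PNil) u u' n & n <= 3 * tsize u].
  move=> ru; exists (Node u Leaf); eexists; split; [|exact: ECons (EId u) (ENil u)|lia].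
  by exists u, Leaf.
have post y v : rep_answer Q y v -> exists v' n,
    [/\ rep_answer Q y v', eval PId v v' n & n <= 1 * tsize v].
  by move=> rv; exists v, (tsize v); split=> //; [apply: EId | rewrite mul1n].
have post_bool y v : rep_answer Q y v -> exists v' n,
    [/\ rep_bool (isSome y) v',
        eval (PIf PId (PCons PNil PNil) PNil) v v' n & n <= 5 * tsize v].
  case: y => [U [w -> _]|->].
    set t := Node Leaf w; have E := ECons (ENil t) (ENil t).
    by exists (Node Leaf Leaf); eexists; split; [|exact: (EIfTrue _ (EId t) isT E)|lia].
  by exists Leaf; eexists; split; [|exact: (EIfFalse _ (EId Leaf) isT (ENil Leaf))|].
have b := bound_linear; split.
- apply: fpt_transfer (b 5) (b 5) pre post_bool (fun=> erefl) _ fptQ.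
  case=> a l [U [m le_m [rU _]]|H]; split=> //; first by exists m, U.
  by case=> m [U [le_m rU]]; case: (H m U le_m rU).
- apply: (@fpt_transfer _ _ _ _ _ _ _ _ _ _ _ _ _ id _ _ _ _ (b 5) (b 1) pre post
    (fun=> erefl) _ fptQ).
  by case=> a l [U [m le_m [rU _]]|//]; exists m.
- apply: (@fpt_transfer _ _ _ _ _ _ _ _ _ _ _ _ _ id _ _ _ _ (b 5) (b 1) pre post
    (fun=> erefl) _ fptQ).
  by case.
apply: (@fpt_transfer _ _ _ _ _ _ _ _ _ _ _ _ _ id _ _ _ _ (b 3) (b 1) pre_free post
    (fun=> erefl) _ fptQ).
by move=> a [U [m _ sh]|H]; [exists m | move=> m U; apply: H].
Qed.
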